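(* Let $n,k$ be integers with $1\le k<n$, and let $K$ and $L$ be bounded Borel sets in $\mathbb{R}^n$ with $L\subset K$. Then $$\big(|K|-|L|\big)^{\frac{n-k}{n}}\ge c_{n,k}^k\,\inf_{F\in{\rm Gr}_{n-k}}\big(|K\cap F|-|L\cap F|\big),$$ where $c_{n,k}^k=\omega_n^{\frac{n-k}{n}}/\omega_{n-k}$.
   Context: $|\cdot|$ denotes volume (Lebesgue measure) of the appropriate dimension, ${\rm Gr}_{n-k}$ is the Grassmannian of $(n-k)$-dimensional linear subspaces of $\mathbb{R}^n$, and $\omega_m$ is the volume of the unit Euclidean ball in $\mathbb{R}^m$. *)

(* Defs.v *)
From HB Require Import structures.
From mathcomp Require Import all_boot all_order all_algebra.
From mathcomp Require Import all_classical all_reals all_analysis.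

Set Implicit Arguments.
Unset Strict Implicit.
Unset Printing Implicit Defensive.

Import Order.TTheory GRing.Theory Num.Theory.
Import numFieldNormedType.Exports.

Local Open Scope classical_set_scope.
Local Open Scope ring_scope.

Section LebesgueTuple.
Variable R : realType.
Let rtuple n := (n.-tuple (measurableTypeR R))%type.

Definition tcons n (p : measurableTypeR R * n.-tuple (measurableTypeR R)) :
    n.+1.-tuple (measurableTypeR R) :=
  [tuple of p.1 :: p.2].

Lemma measurable_tcons n : measurable_fun setT (@tcons n).
Proof. exact: measurable_cons. Qed.

Definition lebesgue_step n
    (mu : set (n.-tuple (measurableTypeR R)) -> \bar R) :
    set (n.+1.-tuple (measurableTypeR R)) -> \bar R :=
  pushforward (lebesgue_measure \x mu)%E (@tcons n).

Section lebesgue_step_measure.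
Variables (n : nat) (mu : {sigma_finite_measure set (rtuple n) -> \bar R}).

HB.instance Definition _ := Measure.copy (lebesgue_step mu)
  (measure_function_pushforward__canonical__measure_function_Measure
    (lebesgue_measure \x mu)%E (@measurable_tcons n)).

Let lebesgue_step_sigma_finite : sigma_finite setT (lebesgue_step mu).
Proof.
have /sigma_finiteP[F [TF ndF Foo]] := sigma_finiteT (@lebesgue_measure R).
have /sigma_finiteP[G [TG ndG Goo]] := sigma_finiteT mu.
pose hd (t : rtuple n.+1) : measurableTypeR R := thead t.
pose tl (t : rtuple n.+1) : rtuple n := [tuple of behead t].
exists (fun k => hd @^-1` F k `&` tl @^-1` G k).
  apply/esym; rewrite -subTset => t _.
  have [i _ Fi] : (\bigcup_i F i) (hd t) by rewrite -TF.
  have [j _ Gj] : (\bigcup_i G i) (tl t) by rewrite -TG.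
  exists (maxn i j) => //; split.
  - exact: (subsetPset _ _ (ndF _ _ (leq_maxl i j))).
  - exact: (subsetPset _ _ (ndG _ _ (leq_maxr i j))).
move=> k; have [mF Fk] := Foo k; have [mG Gk] := Goo k; split.
  apply: measurableI; rewrite -[X in measurable X]setTI.
    exact: (@measurable_tnth _ (measurableTypeR R)).
  exact: measurable_behead.
rewrite /lebesgue_step /pushforward (_ : _ @^-1` _ = F k `*` G k).
  by rewrite product_measure1E// lte_mul_pinfty// ge0_fin_numE.
have tlE x (t : rtuple n) : [tuple of behead (x :: t)] = t by exact/val_inj.
apply/seteqP; split=> -[x t]; rewrite /hd /tl /= ?theadE.
  by move=> [? Gt]; split=> //=; rewrite -(tlE x t).
by move=> [/= ? Gt]; split=> //=; rewrite tlE.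
Qed.

HB.instance Definition _ := Measure_isSigmaFinite.Build _ _ _
  (lebesgue_step mu) lebesgue_step_sigma_finite.

End lebesgue_step_measure.

(* The product measure of n copies of the one-dimensional Lebesgue measure. *)
Fixpoint lebesgue_tuple n : set (n.-tuple (measurableTypeR R)) -> \bar R :=
  if n is n'.+1 then lebesgue_step (@lebesgue_tuple n') else \d_ [tuple].

Lemma lebesgue_tuple_sigma_finite_measure n :
  exists mu : {sigma_finite_measure set (rtuple n) -> \bar R},
    (mu : set _ -> \bar R) = @lebesgue_tuple n.
Proof.
elim: n => [|n [mu IH]] /=; first by exists (\d_ [tuple]).
by exists (lebesgue_step mu); rewrite -IH.
Qed.

Section lebesgue_tuple_measure.
Variable n : nat.

Let lebesgue_tuple0 : @lebesgue_tuple n set0 = 0%E.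
Proof. by have [mu <-] := lebesgue_tuple_sigma_finite_measure n. Qed.

Let lebesgue_tuple_ge0 A : (0 <= @lebesgue_tuple n A)%E.
Proof. by have [mu <-] := lebesgue_tuple_sigma_finite_measure n. Qed.

Let lebesgue_tuple_sigma_additive : semi_sigma_additive (@lebesgue_tuple n).
Proof.
have [mu <-] := lebesgue_tuple_sigma_finite_measure n.
exact: measure_semi_sigma_additive.
Qed.

HB.instance Definition _ := isMeasure.Build _ _ _ (@lebesgue_tuple n)
  lebesgue_tuple0 lebesgue_tuple_ge0 lebesgue_tuple_sigma_additive.

Let lebesgue_tuple_sigma_finite : sigma_finite setT (@lebesgue_tuple n).
Proof.
have [mu <-] := lebesgue_tuple_sigma_finite_measure n.
exact: sigma_finiteT.
Qed.

HB.instance Definition _ := Measure_isSigmaFinite.Build _ _ _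
  (@lebesgue_tuple n) lebesgue_tuple_sigma_finite.

End lebesgue_tuple_measure.

Lemma lebesgue_tuple_box n (A : 'I_n -> set (measurableTypeR R)) :
  (forall i, measurable (A i)) ->
  lebesgue_tuple [set t | forall i, A i (tnth t i)] =
  (\prod_(i < n) lebesgue_measure (A i))%E.
Proof.
elim: n A => [|n IH] A mA /=.
  by rewrite big_ord0 diracE mem_set// => -[].
rewrite big_ord_recl -IH//.
have [mu muE] := lebesgue_tuple_sigma_finite_measure n.
rewrite /lebesgue_step /pushforward -muE -product_measure1E//.
  congr (_ _); apply/seteqP; split=> -[x t] /=.
    move=> At; split=> /=; first by have := At ord0; rewrite tnth0.
    by move=> i; have := At (lift ord0 i); rewrite tnthS.
  move=> [/= Ax At] i.
  by have [j ->|->] := unliftP ord0 i; rewrite ?tnthS ?tnth0.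
rewrite (_ : [set _ | _] = \bigcap_(i in [set: 'I_n])
    (@tnth _ _ ^~ i @^-1` A (lift ord0 i))); last first.
  by apply/seteqP; split=> [t At i _|t At i]; [exact: At|exact: (At i I)].
apply: fin_bigcap_measurable => // i _; rewrite -[X in measurable X]setTI.
by apply: (@measurable_tnth _ (measurableTypeR R)) => //; exact: mA.
Qed.

End LebesgueTuple.

Section LebesgueRV.
Variables (R : realType) (n : nat).

Definition row_of_tuple (t : n.-tuple (measurableTypeR R)) : 'rV[R]_n :=
  \row_i tnth t i.

Definition borel_rV := g_sigma_algebraType (@open 'rV[R]_n).

Lemma measurable_row_of_tuple :
  measurable_fun setT (row_of_tuple : _ -> borel_rV).
Proof.
apply: (@measurability _ _ _ borel_rV _ _ (@open 'rV[R]_n)) => // _ [U oU <-]; rewrite setTI.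
pose box (q : n.-tuple (rat * rat)) : set (n.-tuple (measurableTypeR R)) :=
  \bigcap_(i in [set: 'I_n])
    (@tnth _ _ ^~ i @^-1` `]ratr (tnth q i).1, ratr (tnth q i).2[).
have -> : row_of_tuple @^-1` U =
    \bigcup_(q in [set: n.-tuple (rat * rat)])
      (if pselect (box q `<=` row_of_tuple @^-1` U) then box q else set0).
  apply/seteqP; split=> [t Ut|t [q _]]; last by case: pselect => //= + tq => /(_ _ tq).
  have /nbhs_ballP[e /= e0 eU] : nbhs (row_of_tuple t) U by exact: open_nbhs_nbhs.
  have /choice[p pP] (i : 'I_n) : exists p : rat * rat,
      [/\ tnth t i - e < ratr p.1, ratr p.1 < tnth t i,
          tnth t i < ratr p.2 & ratr p.2 < tnth t i + e].
    have [a] : exists a : rat, ratr a \in `](tnth t i : R) - e, tnth t i[.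
      by apply: rat_in_itvoo; rewrite ltrBlDr ltrDl.
    rewrite in_itv/= => /andP[a1 a2].
    have [b] : exists b : rat, ratr b \in `](tnth t i : R), tnth t i + e[.
      by apply: rat_in_itvoo; rewrite ltrDl.
    rewrite in_itv/= => /andP[b1 b2].
    by exists (a, b).
  exists [tuple p i | i < n] => //.
  case: pselect => [sub|[]] /=.
    move=> i _ /=; rewrite tnth_mktuple in_itv/=; by have [_ -> -> _] := pP i.
  move=> s st; apply: eU; split=> // i j; rewrite !mxE /ball/=.
  have := st j I; rewrite /= tnth_mktuple in_itv/= => /andP[s1 s2].
  have [p1 _ _ p2] := pP j.
  rewrite ltr_distlC.
  by rewrite (lt_trans p1 s1) (lt_trans s2 p2).
apply: countable_bigcupT_measurable => // q; case: pselect => //= _.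
apply: fin_bigcap_measurable => // i _; rewrite -[X in measurable X]setTI.
by apply: (@measurable_tnth _ (measurableTypeR R)) => //; exact: measurable_itv.
Qed.

Definition lebesgue_rV : set borel_rV -> \bar R :=
  pushforward (@lebesgue_tuple R n) (row_of_tuple : _ -> borel_rV).

HB.instance Definition _ := Measure.copy lebesgue_rV
  (measure_function_pushforward__canonical__measure_function_Measure
    (@lebesgue_tuple R n) measurable_row_of_tuple).

Definition vol (A : set 'rV[R]_n) : R := fine (lebesgue_rV A).

End LebesgueRV.

Section Frames.
Variables (R : realType) (n : nat).

Definition grassmannian m : set {vspace 'rV[R]_n} := [set F | \dim F = m].

(* u |-> u *m B is then a linear isometry from R^m onto F. *)
Definition orthonormal_frame m (F : {vspace 'rV[R]_n}) (B : 'M[R]_(m, n)) :=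
  B *m B^T = 1%:M /\ limg (linfun (mulmxr B)) = F.

Lemma gram_schmidt m (A : 'M[R]_(m, n)) : row_free A ->
  exists B : 'M[R]_(m, n), B *m B^T = 1%:M /\ (B :=: A)%MS.
Proof.
elim: m A => [|m IH] A.
  by move=> _; exists A; split => //; apply/matrixP => -[].
rewrite -[m.+1]add1n in A *; rewrite -[A]vsubmxK.
set a := usubmx A; set C := dsubmx A => Afree.
have Cfree : row_free C.
  apply/inj_row_free => u uA'.
  have : row_mx 0 u *m col_mx a C = 0 :> 'rV_n.
    by rewrite mul_row_col mul0mx add0r.
  rewrite -[X in _ = X](mul0mx _ (col_mx a C)) => /(row_free_inj Afree).
  by rewrite -row_mx0 => /eq_row_mx[].
have [D [BB BA]] := IH _ Cfree.
pose v := a - a *m D^T *m D.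
have vB : v *m D^T = 0.
  by rewrite mulmxBl -!mulmxA BB mulmx1 subrr.
have v0 : v != 0.
  apply/eqP => /subr0_eq v0.
  have /submxP[w aE] : (a <= C)%MS by rewrite v0 -BA submxMl.
  have : row_mx (1%:M : 'M[R]_1) (- w) *m col_mx a C = 0 :> 'rV_n.
    by rewrite mul_row_col mul1mx mulNmx -aE subrr.
  rewrite -[X in _ = X](mul0mx _ (col_mx a C)) => /(row_free_inj Afree).
  rewrite -row_mx0 => /eq_row_mx[/matrixP/(_ 0 0)/eqP].
  by rewrite !mxE oner_eq0.
pose s := (v *m v^T) 0 0.
have sE : s = \sum_j v 0 j ^+ 2.
  by rewrite /s mxE; apply: eq_bigr => j _; rewrite [v^T _ _]mxE expr2.
have s0 : 0 < s.
  rewrite lt_neqAle sE sumr_ge0 ?andbT => [|j _]; last exact: sqr_ge0.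
  apply: contra v0; rewrite eq_sym psumr_eq0 => [/allP v0|j _]; last exact: sqr_ge0.
  apply/eqP/rowP => j; rewrite [RHS]mxE.
  by have := v0 j (mem_index_enum _); rewrite /= sqrf_eq0 => /eqP.
pose c := (Num.sqrt s)^-1.
have c0 : c != 0 by rewrite invr_eq0 sqrtr_eq0 -ltNge.
exists (col_mx (c *: v) D); split.
  rewrite tr_col_mx mul_col_row BB linearZ/= -!scalemxAl -scalemxAr vB scaler0.
  rewrite -scalemxAr -[D *m v^T]trmxK trmx_mul trmxK vB trmx0 scaler0 scalerA.
  rewrite [v *m _]mx11_scalar -/s scale_scalar_mx /c -expr2 exprVn.
  by rewrite sqr_sqrtr ?ltW// mulVf ?gt_eqF// -scalar_mx_block.
apply/eqmxP/andP; split; rewrite col_mx_sub; apply/andP; split.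
- rewrite scalemx_sub// addmx_sub//; first by rewrite -addsmxE addsmxSl.
  rewrite eqmx_opp; apply: submx_trans (submxMl _ _) _.
  by rewrite BA -addsmxE addsmxSr.
- by rewrite BA -addsmxE addsmxSr.
- have -> : a = c^-1 *: (c *: v) + a *m D^T *m D.
    by rewrite scalerA mulVf// scale1r subrK.
  rewrite -addsmxE addmx_sub//; first by rewrite scalemx_sub ?addsmxSl.
  by apply: submx_trans (submxMl _ _) _; rewrite addsmxSr.
- by rewrite -BA -addsmxE addsmxSr.
Qed.

Lemma orthonormal_frame_exists (F : {vspace 'rV[R]_n}) :
  exists B : 'M[R]_(\dim F, n), orthonormal_frame F B.
Proof.
pose A := \matrix_i tnth (vbasis F) i : 'M[R]_(\dim F, n).
have uA (u : 'rV_(\dim F)) : u *m A = \sum_i u ord0 i *: (vbasis F)`_i.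
  rewrite mulmx_sum_row; apply: eq_bigr => i _.
  by rewrite rowK (tnth_nth 0).
have Afree : row_free A.
  apply/inj_row_free => u; rewrite uA => u0; apply/rowP => i; rewrite mxE.
  by have /freeP/(_ (u ord0) u0) := basis_free (vbasisP F).
have [B [BB1 BA]] := gram_schmidt Afree; exists B; split => //.
apply/vspaceP => v; apply/idP/idP.
  case/memv_imgP => u _ ->; rewrite lfunE/=.
  have /submxP[w ->] : (u *m B <= A)%MS by rewrite -BA submxMl.
  rewrite uA memv_suml// => i _; rewrite memvZ// vbasis_mem// mem_nth//.
  by rewrite size_tuple.
move=> vF; have /submxP[u vE] : (v <= B)%MS.
  rewrite BA (coord_vbasis vF); apply/submxP.
  exists (\row_i coord (vbasis F) i v); rewrite uA.
  by apply: eq_bigr => i _; rewrite mxE.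
by apply/memv_imgP; exists u; rewrite ?memvf// lfunE/= vE.
Qed.

Definition frame (F : {vspace 'rV[R]_n}) : 'M[R]_(\dim F, n) :=
  sval (cid (orthonormal_frame_exists F)).

(* The choice of the orthonormal basis is irrelevant, Lebesgue measure
   being invariant under the orthogonal group. *)
Definition vol_in (F : {vspace 'rV[R]_n}) (A : set 'rV[R]_n) : R :=
  vol (mulmxr (frame F) @^-1` A).

End Frames.

Arguments grassmannian : clear implicits.

Section Constants.
Variable R : realType.

Definition unit_ball m : set 'rV[R]_m := [set x | \sum_i x ord0 i ^+ 2 <= 1].

Definition omega (m : nat) : R := vol (@unit_ball m).

Definition c_nk (n k : nat) : R :=
  (omega n `^ ((n - k)%N%:R / n%:R) / omega (n - k)%N) `^ k%:R^-1.

Lemma c_nkE n k : (0 < k)%N ->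
  c_nk n k ^+ k = omega n `^ ((n - k)%N%:R / n%:R) / omega (n - k)%N.
Proof.
move=> k0; rewrite -powR_mulrn ?powR_ge0// -powRrM mulVf ?pnatr_eq0 -?lt0n//.
rewrite powRr1// divr_ge0 ?powR_ge0// /omega /vol fine_ge0//.
Qed.

End Constants.

(* Main.v *)
From HB Require Import structures.
Require Import Defs.
From mathcomp Require Import all_boot all_order all_algebra.
From mathcomp Require Import all_classical all_reals all_analysis measurable_realfun.
From mathcomp Require Import ring lra.

Import Order.TTheory GRing.Theory Num.Theory.
Import numFieldNormedType.Exports.

Local Open Scope classical_set_scope.
Local Open Scope ring_scope.

Set Implicit Arguments.
Unset Strict Implicit.
Unset Printing Implicit Defensive.

(** Put [D = K `\` L] and [m = n - k]. Both sides only see [D], and after choosing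
    the radius [rho] for which the [m]-ball of radius [rho] has volume equal to
    the infimum, the inequality says: if every [m]-dimensional central section
    of [D] is at least as large as that of the ball of radius [rho], then [D] is
    at least as large as that ball ([ball_comparison]). Sections are
    parametrized here by the isometries [y |-> y *m B] with [B *m B^T = 1%:M], so
    that sections of sections are sections by composition. Going down one
    dimension at a time, it is enough to treat hyperplanes
    ([ball_comparison_hyperplane]).

    For hyperplanes one averages. Almost every hyperplane of R^(m+1) is a graph
    [{(<y, a>, y)}] with [a] in R^m, and [(1 + |a|^2)^(-(m+1)/2) da] is, up to a
    factor, the rotation invariant measure on hyperplanes. The volume of the
    section of [E] by the graph [F_a] is [(1 + |a|^2)^(1/2)] times the measure of
    [{y | (<y, a>, y) in E}] ([lebesgue_graph_section]). Integrating against the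
    weight, exchanging the integrals, and turning [y] onto the first axis by a
    reflection shows that the weighted integral over [a] of the volume of
    [E `&` F_a] equals the integral of [C / |x|] over [E], for a constant
    [0 < C < +oo] ([weighted_section_integral]). Compare now [D] with the ball
    [B] of radius [rho]. Every section of [D] is at least as large as the
    corresponding one of [B], so the integral of [C / |x|] over [D] is at least
    the integral over [B]; as [C / |x|] is at least [C / rho] on [B], except at
    the origin, and at most [C / rho] off [B], this forces [|B| <= |D|]
    ([bathtub]).

    The computation rests on Tonelli's theorem for the splitting of R^(n+1) into
    a coordinate and R^n, and on the linear change of variables formula
    ([scales_integral_unitmx]), which is proved by block elimination. *)

(** * Tonelli's theorem on R^(n+1) *)

Lemma measurable_coord (R : realType) n (i : 'I_n) :
  measurable_fun setT (fun x : borel_rV R n => (x : 'rV[R]_n) ord0 i : measurableTypeR R).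
Proof.
apply: (measurability _ (RGenOpens.measurableE R)).
move=> _ [_ [a [b ->] <-]]; rewrite setTI.
apply: sub_sigma_algebra.
by apply: open_comp => // x _; exact: coord_continuous.
Qed.

(** The Borel sets of R^n are the images of the product sigma-algebra on tuples,
    so measurability into R^n can be tested on coordinates. *)
Lemma measurable_rVP (R : realType) d (T : measurableType d) n (f : T -> borel_rV R n) :
  (forall i, measurable_fun setT (fun x => (f x : 'rV[R]_n) ord0 i : measurableTypeR R)) ->
  measurable_fun setT f.
Proof.
move=> mf.
rewrite (_ : f = (@row_of_tuple R n : _ -> borel_rV R n) \o
    (fun x => [tuple ((f x : 'rV[R]_n) ord0 i : measurableTypeR R) | i < n])); last first.
  by apply/funext => x; apply/rowP => i; rewrite !mxE tnth_mktuple.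
apply: measurableT_comp; first exact: measurable_row_of_tuple.
apply/measurable_fun_tnthP => i.
rewrite (_ : _ \o _ = fun x => (f x : 'rV[R]_n) ord0 i)//.
by apply/funext => x /=; rewrite tnth_mktuple.
Qed.

Lemma lebesgue_rV_sigma_finite (R : realType) n : sigma_finite setT (@lebesgue_rV R n).
Proof.
have /sigma_finiteP[F [TF ndF Foo]] := sigma_finiteT (@lebesgue_tuple R n).
pose g (x : borel_rV R n) := [tuple ((x : 'rV[R]_n) ord0 i : measurableTypeR R) | i < n].
have mg : measurable_fun setT g.
  apply/measurable_fun_tnthP => i;
  rewrite (_ : _ \o _ = fun x : borel_rV R n => (x : 'rV[R]_n) ord0 i)//.
    exact: measurable_coord.
  by apply/funext => x /=; rewrite tnth_mktuple.
exists (fun k => g @^-1` F k).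
  by rewrite -preimage_bigcup -TF preimage_setT.
move=> k; have [mF Fk] := Foo k; split.
  by rewrite -[X in measurable X]setTI; exact: mg.
rewrite /lebesgue_rV /pushforward (_ : _ @^-1` _ = F k)//.
apply/seteqP; rewrite /g /preimage; split=> t /=; congr (F k _);
  by apply: eq_from_tnth => i; rewrite tnth_mktuple mxE.
Qed.

HB.instance Definition _ (R : realType) n := Measure_isSigmaFinite.Build _ _ _
  (@lebesgue_rV R n) (@lebesgue_rV_sigma_finite R n).

Definition cons_rV (R : realType) n (p : measurableTypeR R * borel_rV R n) : borel_rV R n.+1 :=
  (row_mx (p.1 : R)%:M (p.2 : 'rV[R]_n) : 'rV[R]_(1 + n)).

Lemma cons_rV0 (R : realType) n p : (@cons_rV R n p : 'rV[R]_n.+1) ord0 ord0 = p.1.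
Proof.
transitivity (row_mx ((p.1 : R)%:M : 'M[R]_1) (p.2 : 'rV[R]_n) ord0 (lshift n ord0)).
  by congr (_ _ _); exact/val_inj.
by rewrite row_mxEl mxE eqxx mulr1n.
Qed.

Lemma cons_rVS (R : realType) n p i :
  (@cons_rV R n p : 'rV[R]_n.+1) ord0 (lift ord0 i) = (p.2 : 'rV_n) ord0 i.
Proof.
transitivity (row_mx ((p.1 : R)%:M : 'M[R]_1) (p.2 : 'rV[R]_n) ord0 (rshift 1 i)).
  by congr (_ _ _); exact/val_inj.
by rewrite row_mxEr.
Qed.

Lemma measurable_cons_rV (R : realType) n : measurable_fun setT (@cons_rV R n).
Proof.
apply: measurable_rVP => i; have [j ->|->] := unliftP ord0 i.
  under eq_fun do rewrite cons_rVS.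
  exact: (measurableT_comp (@measurable_coord R n j) measurable_snd).
under eq_fun do rewrite cons_rV0; exact: measurable_fst.
Qed.

Lemma row_of_tcons (R : realType) n t (s : n.-tuple (measurableTypeR R)) :
  row_of_tuple (tcons (t, s)) = cons_rV (t, row_of_tuple s).
Proof.
apply/rowP => i; have [j ->|->] := unliftP ord0 i.
  by rewrite cons_rVS !mxE tnthS.
by rewrite cons_rV0 mxE tnth0.
Qed.

(** The recursive definition of Lebesgue measure on tuples, transported to row
    vectors. *)
Lemma lebesgue_rVS (R : realType) n (A : set (borel_rV R n.+1)) : measurable A ->
  lebesgue_rV A = pushforward (lebesgue_measure \x @lebesgue_rV R n)%E (@cons_rV R n) A.
Proof.
move=> mA; rewrite /lebesgue_rV /pushforward/= /lebesgue_step /pushforward.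
rewrite /product_measure1; apply: eq_integral => t _ /=.
congr (lebesgue_tuple _); apply/seteqP; rewrite /xsection /preimage; split=> s/=;
  by rewrite !inE/= row_of_tcons.
Qed.

Section tonelli.
Variables (R : realType) (n : nat) (f : borel_rV R n.+1 -> \bar R).
Hypothesis (mf : measurable_fun [set: borel_rV R n.+1] f) (f0 : forall x, (0 <= f x)%E).

Lemma integral_rVS : (\int[@lebesgue_rV R n.+1]_x f x =
  \int[(lebesgue_measure \x @lebesgue_rV R n)]_p f (cons_rV p))%E.
Proof.
have mc := @measurable_cons_rV R n.
have E := @ge0_integral_pushforward _ _ _ _ R _ mc
  (lebesgue_measure \x @lebesgue_rV R n)%E setT f measurableT mf (fun y _ => f0 y).
rewrite preimage_setT in E.
rewrite -[RHS]E.
by apply: eq_measure_integral => A mA _; exact: lebesgue_rVS.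
Qed.

Lemma integral_rVS_head : (\int[@lebesgue_rV R n.+1]_x f x =
  \int[lebesgue_measure]_t \int[@lebesgue_rV R n]_x f (cons_rV (t, x)))%E.
Proof.
rewrite integral_rVS (fubini_tonelli1 (f \o @cons_rV R n)) => [//||x/=].
  exact: (measurableT_comp mf (@measurable_cons_rV R n)).
exact: f0.
Qed.

Lemma integral_rVS_tail : (\int[@lebesgue_rV R n.+1]_x f x =
  \int[@lebesgue_rV R n]_x \int[lebesgue_measure]_t f (cons_rV (t, x)))%E.
Proof.
rewrite integral_rVS (fubini_tonelli2 (f \o @cons_rV R n)) => [//||x/=].
  exact: (measurableT_comp mf (@measurable_cons_rV R n)).
exact: f0.
Qed.

End tonelli.

(** * Translations *)

(** The common source of all changes of variables below: it suffices to know how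
    the measure of a set is rescaled. *)
Lemma ge0_integral_scaling_map d (T : measurableType d) (R : realType)
    (mu : {measure set T -> \bar R}) (phi : T -> T) (c : {nonneg R}) (f : T -> \bar R) :
    measurable_fun setT phi ->
    (forall A, measurable A -> mu (phi @^-1` A) = (c%:num%:E * mu A)%E) ->
    measurable_fun setT f -> (forall x, (0 <= f x)%E) ->
  (\int[mu]_x f (phi x) = c%:num%:E * \int[mu]_x f x)%E.
Proof.
move=> mphi muphi mf f0.
have E := @ge0_integral_pushforward _ _ _ _ R _ mphi mu setT f measurableT mf (fun y _ => f0 y).
rewrite preimage_setT in E; rewrite -[LHS]E -ge0_integral_mscale//.
by apply: eq_measure_integral => A mA _; exact: muphi.
Qed.


Lemma lebesgue_measure_translation (R : realType) (b : R) (A : set (measurableTypeR R)) :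
  measurable A -> lebesgue_measure ((fun t => t + b) @^-1` A) = lebesgue_measure A.
Proof.
have mb : measurable_fun setT (fun t : measurableTypeR R => t + b : measurableTypeR R).
  exact: measurable_funD.
move=> mA; apply/esym.
apply: (@lebesgue_measure_unique R (measure_function_pushforward__canonical__measure_function_Measure
  lebesgue_measure mb)) => // _ [[x y]] _ <- /=.
rewrite /pushforward (_ : _ @^-1` _ = `]x - b, y - b]%classic); last first.
  by apply/seteqP; split => t; rewrite /= !in_itv/= ltrBlDr lerBrDr.
by rewrite !lebesgue_measure_itv/= !lte_fin ltrD2r -!EFinB opprB addrA subrK.
Qed.

Lemma lebesgue_measure_scale_gt0 (R : realType) (a : R) (A : set (measurableTypeR R)) :
  0 < a -> measurable A ->
  lebesgue_measure ((fun t => t * a) @^-1` A) = (a^-1%:E * lebesgue_measure A)%E.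
Proof.
move=> a0.
have ma : measurable_fun setT (fun t : measurableTypeR R => t * a : measurableTypeR R).
  exact: measurable_funM.
move=> mA.
rewrite (@lebesgue_measure_unique R (mscale (NngNum (ltW a0))
  (measure_function_pushforward__canonical__measure_function_Measure
  lebesgue_measure ma)) _ A)//=.
  by rewrite /mscale/= muleA -EFinM mulVf ?gt_eqF// mul1e.
move=> _ [[x y]] _ <- /=.
rewrite /mscale/= /pushforward (_ : _ @^-1` _ = `]x / a, y / a]%classic); last first.
  by apply/seteqP; split => t; rewrite /= !in_itv/= ltr_pdivrMr// ler_pdivlMr.
rewrite !lebesgue_measure_itv/= !lte_fin ltr_pM2r ?invr_gt0//.
case: ifPn => _; last by rewrite mule0.
by rewrite -!EFinB -EFinM -mulrBl mulrCA mulfV ?gt_eqF// mulr1.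
Qed.

(** A negative factor is a positive one followed by [t |-> - t], which preserves
    Lebesgue measure. *)
Lemma lebesgue_measure_scale (R : realType) (a : R) (A : set (measurableTypeR R)) :
  a != 0 -> measurable A ->
  lebesgue_measure ((fun t => t * a) @^-1` A) = (`|a|^-1%:E * lebesgue_measure A)%E.
Proof.
move=> a0 mA; have [|a_gt0] := ltP 0 a.
  by move=> a_gt0; rewrite gtr0_norm// lebesgue_measure_scale_gt0.
have Na_gt0 : 0 < - a by rewrite oppr_gt0 lt_neqAle a0.
have mNA : measurable (-%R @^-1` A : set (measurableTypeR R)).
  by rewrite -[X in measurable X]setTI; exact: measurable_funN.
rewrite ltr0_norm ?lt_neqAle ?a0//.
have NE : lebesgue_measure (-%R @^-1` A : set (measurableTypeR R)) = lebesgue_measure A.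
  exact: lebesgue_measureN.
rewrite -NE -(lebesgue_measure_scale_gt0 Na_gt0 mNA).
by congr (lebesgue_measure _); apply/seteqP; split => t /=; rewrite mulrN opprK.
Qed.

Lemma integral_translation1 (R : realType) (b : R) (f : measurableTypeR R -> \bar R) :
  measurable_fun setT f -> (forall t, (0 <= f t)%E) ->
  (\int[lebesgue_measure]_t f (t + b)%R = \int[lebesgue_measure]_t f t)%E.
Proof.
move=> mf f0.
rewrite (@ge0_integral_scaling_map _ _ _ lebesgue_measure
  (fun t : measurableTypeR R => t + b : measurableTypeR R) 1%:nng f)//= ?mul1e//.
  exact: measurable_funD.
by move=> A mA; rewrite mul1e; exact: lebesgue_measure_translation.
Qed.

Lemma integral_scale1 (R : realType) (a : R) (f : measurableTypeR R -> \bar R) :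
  a != 0 -> measurable_fun setT f -> (forall t, (0 <= f t)%E) ->
  (\int[lebesgue_measure]_t f (t * a)%R = `|a|^-1%:E * \int[lebesgue_measure]_t f t)%E.
Proof.
move=> a0 mf f0.
have ia : 0 <= `|a|^-1 by rewrite invr_ge0.
rewrite (@ge0_integral_scaling_map _ _ _ lebesgue_measure
  (fun t : measurableTypeR R => t * a : measurableTypeR R) (NngNum ia) f)//=.
  exact: measurable_funM.
by move=> A mA; exact: lebesgue_measure_scale.
Qed.

Lemma measurable_cons_rVr (R : realType) n (t : R) :
  measurable_fun setT (fun x => @cons_rV R n (t, x)).
Proof. exact: (measurableT_comp (@measurable_cons_rV R n) (measurable_pair1 t)). Qed.

Lemma measurable_cons_rVl (R : realType) n x :
  measurable_fun setT (fun t => @cons_rV R n (t, x)).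
Proof. exact: (measurableT_comp (@measurable_cons_rV R n) (measurable_pair2 x)). Qed.

Lemma measurable_mulmx (R : realType) m n (M : 'M[R]_(m, n)) :
  measurable_fun setT (fun x : borel_rV R m => (x : 'rV_m) *m M : borel_rV R n).
Proof.
apply: measurable_rVP => i; under eq_fun do rewrite mxE.
apply: measurable_sum => j; apply: measurable_funM => //.
exact: measurable_coord.
Qed.

Lemma measurable_preimage_mulmx (R : realType) m n (M : 'M[R]_(m, n)) (A : set (borel_rV R n)) :
  measurable A -> measurable ((mulmxr M : borel_rV R m -> borel_rV R n) @^-1` A).
Proof.
by move=> mA; rewrite -[X in measurable X]setTI; exact: measurable_mulmx.
Qed.
Lemma measurable_addmx (R : realType) n (v : 'rV[R]_n) :
  measurable_fun setT (fun x : borel_rV R n => (x : 'rV_n) + v : borel_rV R n).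
Proof.
apply: measurable_rVP => i; under eq_fun do rewrite mxE.
apply: measurable_funD => //.
exact: measurable_coord.
Qed.

Lemma rV_cons (R : realType) n (x : 'rV[R]_n.+1) :
  x = cons_rV (x ord0 ord0, \row_i x ord0 (lift ord0 i)).
Proof.
apply/rowP => i; have [j ->|->] := unliftP ord0 i; last by rewrite cons_rV0.
by rewrite cons_rVS mxE.
Qed.

Lemma cons_rVD (R : realType) n (t s : R) (x y : 'rV[R]_n) :
  (cons_rV (t, x) : 'rV[R]_n.+1) + (cons_rV (s, y) : 'rV[R]_n.+1) = cons_rV (t + s, x + y).
Proof.
rewrite /cons_rV/= [LHS](@add_row_mx _ 1 1 n).
by rewrite [(t + s)%:M]raddfD.
Qed.

Lemma integral_translation (R : realType) n (v : 'rV[R]_n) (f : borel_rV R n -> \bar R) :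
  measurable_fun setT f -> (forall x, (0 <= f x)%E) ->
  (\int[@lebesgue_rV R n]_x f ((x : 'rV_n) + v)%R = \int[@lebesgue_rV R n]_x f x)%E.
Proof.
elim: n v f => [|n IH] v f mf f0.
  by apply: eq_integral => x _; congr f; apply/rowP => -[].
rewrite [v]rV_cons; set b := v _ _; set w := \row_i _.
rewrite integral_rVS_head//; last exact: (measurableT_comp mf (@measurable_addmx R _ _)).
rewrite (integral_rVS_head mf f0).
pose g t := (\int[@lebesgue_rV R n]_x f (cons_rV (t, x)))%E.
rewrite -(@integral_translation1 R b g).
- apply: eq_integral => t _; rewrite /g.
  rewrite -(IH w (fun x => f (cons_rV (t + b, x))))//.
    by apply: eq_integral => x _; rewrite cons_rVD.
  exact: (measurableT_comp mf (@measurable_cons_rVr R _ _)).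
- exact: (measurable_fun_fubini_tonelli_F (f \o @cons_rV R n)
    (measurableT_comp mf (@measurable_cons_rV R n)) (fun x => f0 _)).
- by move=> t; apply: integral_ge0.
Qed.

(** * Linear change of variables *)
Definition scales_integral (R : realType) n (M : 'M[R]_n) :=
  forall f : borel_rV R n -> \bar R, measurable_fun setT f -> (forall x, (0 <= f x)%E) ->
  (\int[@lebesgue_rV R n]_x f ((x : 'rV_n) *m M)%R =
    `|\det M|^-1%:E * \int[@lebesgue_rV R n]_x f x)%E.

Lemma scales_integralM (R : realType) n (A B : 'M[R]_n) :
  scales_integral A -> scales_integral B -> scales_integral (A *m B).
Proof.
move=> hA hB f mf f0.
rewrite det_mulmx normrM invfM EFinM -muleA -hB//.
have mfB := measurableT_comp mf (@measurable_mulmx R _ _ B).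
rewrite -(hA _ mfB (fun x => f0 _)).
by apply: eq_integral => x _ /=; rewrite mulmxA.
Qed.

Lemma cons_rV_mulmx (R : realType) n t (x : 'rV[R]_n) (a : 'M[R]_1) (b : 'rV[R]_n)
    (c : 'cV[R]_n) (S : 'M[R]_n) :
  (cons_rV (t, x) : 'rV[R]_(1 + n)) *m block_mx a b c S =
  cons_rV ((t * a ord0 ord0 + (x *m c) ord0 ord0)%R, (t *: b + x *m S)%R).
Proof.
rewrite /cons_rV/= mul_row_block !mul_scalar_mx [(_ + _)%:M]raddfD.
by rewrite [a in LHS]mx11_scalar [x *m c in LHS]mx11_scalar scale_scalar_mx.
Qed.

(** Integrate in [x] first: for fixed [t] the map is the one given by [S] followed
    by the translation by [t *: b]; what remains is the scaling [t |-> t * a]. *)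
Lemma scales_integral_upper (R : realType) n (a : R) (b : 'rV[R]_n) (S : 'M[R]_n) :
  a != 0 -> scales_integral S ->
  scales_integral (block_mx a%:M b 0 S : 'M[R]_(1 + n)).
Proof.
move=> a0 hS f mf f0.
rewrite det_ublock det_scalar1 normrM invfM.
rewrite (integral_rVS_head (measurableT_comp mf
  (@measurable_mulmx R n.+1 n.+1 (block_mx a%:M b 0 S)))) => [|x]; last exact: f0.
rewrite (integral_rVS_head mf f0).
pose g t := (\int[@lebesgue_rV R n]_x f (cons_rV (t, x)))%E.
have mg : measurable_fun setT g.
  exact: (measurable_fun_fubini_tonelli_F (f \o @cons_rV R n)
    (measurableT_comp mf (@measurable_cons_rV R n)) (fun x => f0 _)).
have g0 t : (0 <= g t)%E by apply: integral_ge0.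
transitivity (\int[lebesgue_measure]_t (`|\det S|^-1%:E * g (t * a)%R))%E.
  apply: eq_integral => t _.
  have mft := measurableT_comp mf (@measurable_cons_rVr R n (t * a)).
  have mftb := measurableT_comp mft (@measurable_addmx R n (t *: b)).
  rewrite /g -(integral_translation (t *: b) mft (fun x => f0 _)).
  rewrite -(hS _ mftb (fun x => f0 _)).
  apply: eq_integral => x _ /=; congr f; rewrite [LHS]cons_rV_mulmx.
  by rewrite mulmx0 !mxE eqxx mulr1n addr0 addrC.
have mga : measurable_fun setT (fun t : measurableTypeR R => g (t * a)).
  have ma : measurable_fun setT (fun t : measurableTypeR R => t * a : measurableTypeR R).
    exact: measurable_funM.
  exact: (measurableT_comp mg ma).
have iS : 0 <= `|\det S|^-1 by rewrite invr_ge0.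
rewrite (ge0_integralZl_EFin lebesgue_measure measurableT (fun t _ => g0 _) mga iS).
by rewrite (integral_scale1 a0 mg g0) muleA -EFinM mulrC.
Qed.

(** Integrate in [t] first: for fixed [x] the map is a translation of [t]. *)
Lemma scales_integral_lower (R : realType) n (c : 'cV[R]_n) :
  scales_integral (block_mx 1%:M 0 c 1%:M : 'M[R]_(1 + n)).
Proof.
move=> f mf f0.
rewrite det_lblock !det1 mulr1 normr1 invr1 mul1e.
rewrite (integral_rVS_tail (measurableT_comp mf
  (@measurable_mulmx R n.+1 n.+1 (block_mx 1%:M 0 c 1%:M)))) => [|x]; last exact: f0.
rewrite (integral_rVS_tail mf f0).
apply: eq_integral => x _.
have mfx := measurableT_comp mf (@measurable_cons_rVl R n x).
rewrite -(integral_translation1 ((x *m c) ord0 ord0) mfx (fun x => f0 _)).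
apply: eq_integral => t _ /=; congr f; rewrite [LHS]cons_rV_mulmx.
by rewrite mulmx1 scaler0 add0r !mxE eqxx mulr1n mulr1.
Qed.

Lemma scales_integral1 (R : realType) n : scales_integral (1%:M : 'M[R]_n).
Proof.
move=> f mf f0; rewrite det1 normr1 invr1 mul1e.
by apply: eq_integral => x _; rewrite mulmx1.
Qed.

(** One step of block elimination, [S] being the Schur complement of the pivot. *)
Lemma scales_integral_pivot (R : realType) n (M : 'M[R]_(1 + n)) :
  (forall S : 'M[R]_n, S \in unitmx -> scales_integral S) ->
  M \in unitmx -> ulsubmx M ord0 ord0 != 0 -> scales_integral M.
Proof.
move=> IH uM; set a := ulsubmx M ord0 ord0 => a0.
pose c := a^-1 *: dlsubmx M.
pose S := drsubmx M - c *m ursubmx M.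
have E : M = block_mx 1%:M 0 c 1%:M *m block_mx a%:M (ursubmx M) 0 S.
  rewrite mulmx_block !mul1mx ?mul0mx ?mulmx0 ?addr0.
  rewrite /S addrC subrK /c mul_mx_scalar scalerA mulfV// scale1r.
  by rewrite -[LHS]submxK -mx11_scalar.
rewrite E; apply: scales_integralM; first exact: scales_integral_lower.
apply: scales_integral_upper => //; apply: IH.
move: uM; rewrite !unitmxE E det_mulmx det_lblock det_ublock !det1 !mul1r.
by rewrite det_scalar1 unitrM => /andP[].
Qed.

(** If the pivot vanishes, adding to the first row a row with a nonzero entry in
    the first column produces one; undoing this is again an upper block map. *)
Lemma scales_integral_unitmx (R : realType) n (M : 'M[R]_n) :
  M \in unitmx -> scales_integral M.
Proof.
elim: n M => [|n IH] M uM.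
  by rewrite (_ : M = 1%:M); [exact: scales_integral1|apply/matrixP => -[]].
rewrite -[n.+1]/(1 + n)%N in M uM *.
have [a0|a0] := eqVneq (ulsubmx M ord0 ord0) 0; last exact: scales_integral_pivot.
have [c0|[i ci]] : dlsubmx M = 0 \/ exists i, dlsubmx M i ord0 != 0.
  have [/existsP|/existsPn c0] := boolP [exists i, dlsubmx M i ord0 != 0]; first by right.
  by left; apply/matrixP => i j; rewrite ord1 [RHS]mxE; apply/eqP; rewrite -[_ == _]negbK.
  have : block_mx (ulsubmx M) (ursubmx M) (dlsubmx M) (drsubmx M) \in unitmx by rewrite submxK.
  by rewrite c0 unitmxE det_ublock [ulsubmx M]mx11_scalar a0 det_scalar1 mul0r unitr0.
pose e : 'rV[R]_n := delta_mx ord0 i.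
have E : M = block_mx 1%:M (- e) 0 1%:M *m (block_mx 1%:M e 0 1%:M *m M).
  rewrite mulmxA mulmx_block !mul1mx !mulmx1 ?mul0mx ?mulmx0 ?addr0 add0r subrr.
  by rewrite -scalar_mx_block mul1mx.
rewrite E; apply: scales_integralM.
  by apply: scales_integral_upper; [exact: oner_neq0|exact: scales_integral1].
apply: scales_integral_pivot => //.
  by rewrite unitmx_mul uM andbT unitmxE det_ublock !det1 mulr1 unitr1.
rewrite -[M]submxK mulmx_block block_mxKul mul1mx mxE a0 add0r.
by rewrite -rowE mxE.
Qed.

Lemma lebesgue_rV_mulmx (R : realType) n (M : 'M[R]_n) (A : set (borel_rV R n)) :
  M \in unitmx -> measurable A ->
  lebesgue_rV ((mulmxr M : _ -> 'rV[R]_n) @^-1` A) = (`|\det M|^-1%:E * lebesgue_rV A)%E.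
Proof.
move=> uM mA.
have mMA : measurable ((mulmxr M : borel_rV R n -> borel_rV R n) @^-1` A).
  exact: measurable_preimage_mulmx.
rewrite -[in LHS](setIT (_ @^-1` _)) -(integral_indic _ measurableT mMA).
rewrite -[in RHS](setIT A) -(integral_indic _ measurableT mA).
have mI : measurable_fun setT (fun x : borel_rV R n => (\1_A x)%:E : \bar R).
  by apply/measurable_EFinP; exact: measurable_indic.
by rewrite -(scales_integral_unitmx uM mI (fun x => _))// => x; rewrite lee_fin.
Qed.

Lemma limg_mulmxrE (R : realType) m n (A : 'M[R]_(m, n)) (v : 'rV[R]_n) :
  (v \in limg (linfun (mulmxr A))) = (v <= A)%MS.
Proof.
apply/memv_imgP/submxP => [[u _ ->]|[u ->]].
  by exists u; rewrite lfunE.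
by exists u; rewrite ?memvf// lfunE.
Qed.

Lemma limg_mulmxr_submx (R : realType) m m' n (A : 'M[R]_(m, n)) (B : 'M[R]_(m', n)) :
  limg (linfun (mulmxr A)) = limg (linfun (mulmxr B)) :> {vspace 'rV[R]_n} -> (A <= B)%MS.
Proof.
by move=> AB; apply/row_subP => i; rewrite -limg_mulmxrE -AB limg_mulmxrE row_sub.
Qed.

Lemma orthonormal_frame_rank (R : realType) m n (F : {vspace 'rV[R]_n}) (B : 'M[R]_(m, n)) :
  orthonormal_frame F B -> \rank B = m.
Proof. by move=> [BB _]; apply/eqP/row_freeP; exists B^T. Qed.

(** * Sections and isometric parametrizations *)

(** The Gram determinant measures how far an injective parametrization of a
    subspace is from an isometric one: [T = M *m B] with [M] square, and
    [T *m T^T = M *m M^T]. *)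
Lemma lebesgue_rV_row_basis (R : realType) m n (T B : 'M[R]_(m, n))
    (A : set (borel_rV R n)) :
  row_free T -> B *m B^T = 1%:M -> (T <= B)%MS -> measurable A ->
  lebesgue_rV ((mulmxr T : _ -> 'rV[R]_n) @^-1` A) =
  ((Num.sqrt (\det (T *m T^T)))^-1%:E * lebesgue_rV ((mulmxr B : _ -> 'rV[R]_n) @^-1` A))%E.
Proof.
move=> fT BB /submxP[M TE] mA.
have uM : M \in unitmx.
  rewrite -row_free_unit; apply/row_freeP; move/row_freeP: fT => [C].
  by rewrite TE -mulmxA => MC; exists (B *m C).
have -> : T *m T^T = M *m M^T.
  by rewrite TE trmx_mul mulmxA -[M *m B *m _]mulmxA BB mulmx1.
rewrite det_mulmx det_tr -expr2 sqrtr_sqr -lebesgue_rV_mulmx//.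
  by congr lebesgue_rV; apply/seteqP; split => x; rewrite /= TE mulmxA.
exact: measurable_preimage_mulmx.
Qed.

(** Used to transport along [m = \dim F], the size of the frames of [F] being
    the dependent index [\dim F]. *)
Lemma orthonormal_frame_size (R : realType) m n (F : {vspace 'rV[R]_n}) (B : 'M[R]_(m, n)) :
  orthonormal_frame F B -> m = \dim F.
Proof.
move=> oB; have [B' oB'] := orthonormal_frame_exists F.
rewrite -(orthonormal_frame_rank oB) -[RHS](orthonormal_frame_rank oB').
by apply/eqP; rewrite eqn_leq !mxrankS// limg_mulmxr_submx// ?(proj2 oB) (proj2 oB').
Qed.

Lemma vol_in_orthonormal_frame (R : realType) m n (F : {vspace 'rV[R]_n})
    (B : 'M[R]_(m, n)) (A : set (borel_rV R n)) :
  orthonormal_frame F B -> measurable A ->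
  vol_in F A = vol ((mulmxr B : _ -> 'rV[R]_n) @^-1` A).
Proof.
move=> oB mA; rewrite /vol_in /vol /frame; case: cid => B' /= oB'; congr fine.
move: B' oB'; rewrite -(orthonormal_frame_size oB) => B' [BB' BF'].
rewrite (lebesgue_rV_row_basis _ (proj1 oB) _ mA).
- by rewrite BB' det1 sqrtr1 invr1 mul1e.
- by apply/row_freeP; exists B'^T.
- by apply: limg_mulmxr_submx; rewrite (proj2 oB).
Qed.

(** * Balls and cubes *)
Section sqnorm.
Variable R : realType.

Definition sqnorm n (x : 'rV[R]_n) := \sum_i x ord0 i ^+ 2.

Lemma sqnorm_ge0 n (x : 'rV[R]_n) : 0 <= sqnorm x.
Proof. by apply: sumr_ge0 => i _; exact: sqr_ge0. Qed.

Lemma sqnormE n (x : 'rV[R]_n) : sqnorm x = (x *m x^T) ord0 ord0.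
Proof. by rewrite mxE; apply: eq_bigr => i _; rewrite [x^T _ _]mxE expr2. Qed.

Lemma sqnorm_mulmx m n (B : 'M[R]_(m, n)) x : B *m B^T = 1%:M ->
  sqnorm (x *m B) = sqnorm x.
Proof. by move=> BB; rewrite !sqnormE trmx_mul mulmxA -(mulmxA x) BB mulmx1. Qed.

Lemma sqnorm_cons n t (x : 'rV[R]_n) : sqnorm (cons_rV (t, x) : 'rV[R]_n.+1) = t ^+ 2 + sqnorm x.
Proof.
rewrite /sqnorm big_ord_recl cons_rV0/=; congr (_ + _).
by apply: eq_bigr => i _; rewrite cons_rVS.
Qed.

Lemma sqnormZ n a (x : 'rV[R]_n) : sqnorm (a *: x) = a ^+ 2 * sqnorm x.
Proof. by rewrite /sqnorm mulr_sumr; apply: eq_bigr => i _; rewrite mxE exprMn. Qed.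

Lemma sqnorm_eq0 n (x : 'rV[R]_n) : (sqnorm x == 0) = (x == 0).
Proof.
rewrite psumr_eq0 => [|i _]; last exact: sqr_ge0.
apply/allP/eqP => [x0|-> i _]; last by rewrite /= mxE expr0n/= eqxx.
apply/rowP => i; rewrite [RHS]mxE.
by have := x0 i (mem_index_enum _); rewrite /= sqrf_eq0 => /eqP.
Qed.

Lemma measurable_sqnorm n : measurable_fun setT (@sqnorm n : borel_rV R n -> measurableTypeR R).
Proof.
apply: measurable_sum => i; under eq_fun do rewrite expr2.
by apply: measurable_funM; exact: measurable_coord.
Qed.

Definition eball n (r : R) : set 'rV[R]_n := [set x | sqnorm x <= r ^+ 2].
Arguments eball : clear implicits.

Lemma measurable_eball n r : measurable (eball n r : set (borel_rV R n)).
Proof.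
rewrite (_ : eball n r = setT `&`
    (@sqnorm n : borel_rV R n -> measurableTypeR R) @^-1` `]-oo, (r ^+ 2)%R]).
  exact: measurable_sqnorm.
by rewrite setTI; apply/seteqP; split => x; rewrite /eball/= in_itv.
Qed.

Lemma unit_ballE n : @unit_ball R n = eball n 1.
Proof. by rewrite /unit_ball /eball expr1n. Qed.

Lemma lebesgue_eball n (r : R) : 0 < r ->
  lebesgue_rV (eball n r) = ((r ^+ n)%:E * lebesgue_rV (eball n 1))%E.
Proof.
move=> r0.
have ri0 : r^-1 != 0 by rewrite invr_eq0 gt_eqF.
have uM : (r^-1)%:M \in @unitmx R n by rewrite unitmxE det_scalar unitrX// unitfE.
have := lebesgue_rV_mulmx uM (@measurable_eball n 1).
rewrite det_scalar normrX normfV gtr0_norm// exprVn invrK => <-.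
congr lebesgue_rV; apply/seteqP; split => x; rewrite /eball/= mul_mx_scalar sqnormZ expr1n;
  by rewrite exprVn ler_pdivrMl ?exprn_gt0// mulr1.
Qed.

Definition cube n (r : R) : set 'rV[R]_n := [set x | forall i, `|x ord0 i| <= r].
Arguments cube : clear implicits.

Lemma lebesgue_cube n (r : R) : 0 <= r -> lebesgue_rV (cube n r) = ((r *+ 2) ^+ n)%:E.
Proof.
move=> r0; rewrite /lebesgue_rV /pushforward.
transitivity (lebesgue_tuple
    [set t : n.-tuple (measurableTypeR R) | forall i, `[- r, r]%classic (tnth t i)]).
  congr lebesgue_tuple; apply/seteqP; split => t /= + i => /(_ i);
    by rewrite /= mxE in_itv/= ler_norml.
rewrite (@lebesgue_tuple_box R n (fun=> `[- r, r]%classic)) => [|i]; last exact: measurable_itv.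
under eq_bigr do rewrite lebesgue_measure_itv/= lte_fin.
have -> : (if - r < r then (r%:E + - (- r)%:E)%E else 0%E) = (r *+ 2)%:E.
  case: ifPn => [_|]; first by rewrite -EFinN -EFinD opprK mulr2n.
  rewrite -leNgt => rN; have -> : r = 0 by lra.
  by rewrite mul0rn.
by rewrite (prodEFin _ xpredT (fun=> r *+ 2)) prodr_const card_ord.
Qed.


Lemma eball_cube n (r : R) : eball n r `<=` cube n `|r|.
Proof.
move=> x; rewrite /eball/= => xr i.
rewrite -ler_sqr ?nnegrE// real_normK ?num_real// real_normK ?num_real//.
apply: le_trans xr; rewrite /sqnorm (bigD1 i)//= lerDl.
by apply: sumr_ge0 => j _; exact: sqr_ge0.
Qed.

Lemma measurable_cube n (r : R) : measurable (cube n r : set (borel_rV R n)).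
Proof.
rewrite (_ : cube n r = \bigcap_(i in [set: 'I_n])
    ((fun x : borel_rV R n => (x : 'rV[R]_n) ord0 i : measurableTypeR R) @^-1` `[- r, r])); last first.
  apply/seteqP; split => x; rewrite /cube/=.
    by move=> xr i _; rewrite /= in_itv/= -ler_norml.
  by move=> xr i; have := xr i I; rewrite /= in_itv/= -ler_norml.
apply: fin_bigcap_measurable => // i _; rewrite -[X in measurable X]setTI.
by apply: measurable_coord => //; exact: measurable_itv.
Qed.

Lemma lebesgue_eball_lty n (r : R) : (lebesgue_rV (eball n r) < +oo)%E.
Proof.
apply: le_lt_trans (ltry ((`|r| *+ 2) ^+ n)).
rewrite -lebesgue_cube//.
apply: le_measure; rewrite ?inE; [exact: measurable_eball|exact: measurable_cube|].
exact: eball_cube.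
Qed.

Lemma eball_preimage m n (B : 'M[R]_(m, n)) (r : R) : B *m B^T = 1%:M ->
  (mulmxr B : _ -> 'rV[R]_n) @^-1` eball n r = eball m r.
Proof. by move=> BB; apply/seteqP; split => x; rewrite /eball/= sqnorm_mulmx. Qed.

Lemma measurable_rV_set0 n : measurable ([set 0] : set (borel_rV R n)).
Proof.
rewrite (_ : [set 0] = eball n 0); first exact: measurable_eball.
apply/seteqP; split => y; rewrite /eball/= expr0n/=.
  by move=> ->; rewrite le_eqVlt sqnorm_eq0 eqxx.
by move=> y0; apply/eqP; rewrite -sqnorm_eq0 eq_le y0 sqnorm_ge0.
Qed.

Lemma lebesgue_rV_set0 n : (0 < n)%N -> lebesgue_rV [set (0 : 'rV[R]_n)] = 0%E.
Proof.
move=> n0; rewrite (_ : [set 0] = cube n 0); last first.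
  apply/seteqP; split => x; rewrite /cube/=; first by move=> -> i; rewrite mxE normr0.
  by move=> x0; apply/rowP => i; rewrite [RHS]mxE; apply/eqP; rewrite -normr_le0.
by rewrite lebesgue_cube// mul0rn expr0n gtn_eqF.
Qed.

Lemma bounded_set_eball n (K : set 'rV[R]_n) : bounded_set K ->
  exists r, K `<=` eball n r.
Proof.
move=> /pinfty_ex_gt0[M /ltW M0 KM]; exists (n.+1%:R * M) => x /KM /= xM; rewrite /eball/=.
apply: (@le_trans _ _ (\sum_(i < n) M ^+ 2)).
  apply: ler_sum => i _; rewrite -[leLHS]real_normK ?num_real// ler_sqr ?nnegrE//.
  apply: le_trans xM; rewrite [leRHS]/Num.norm/= mx_normrE.
  exact: (le_bigmax _ (fun ij : 'I_1 * 'I_n => `|x ij.1 ij.2|) (ord0, i)).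
rewrite sumr_const card_ord -[leLHS]mulr_natl exprMn; apply: ler_wpM2r; first exact: sqr_ge0.
rewrite -natrX ler_nat.
by rewrite (leq_trans (leqnSn n))// -{1}[n.+1]expn1 leq_pexp2l.
Qed.

End sqnorm.
Arguments eball {R} n r.
Arguments cube {R} n r.

Lemma measurable_invsqrt d (T : measurableType d) (R : realType) (f : T -> measurableTypeR R) :
  measurable_fun setT f -> (forall x, 0 <= f x) ->
  measurable_fun setT (fun x => (Num.sqrt (f x))^-1 : measurableTypeR R).
Proof.
move=> mf f0.
rewrite (_ : (fun _ => _) = (fun t : measurableTypeR R => t `^ (- 2^-1) : measurableTypeR R) \o f).
  exact: (measurableT_comp (measurable_powR _) mf).
by apply/funext => x /=; rewrite powRN powR12_sqrt.
Qed.

(** * The weights (1 + |b|^2)^(-p/2) *)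
Section inverse_power_weight.
Variable R : realType.

Definition weight n p (b : 'rV[R]_n) : R := (Num.sqrt (1 + sqnorm b))^-1 ^+ p.

Lemma weight_gt0 n p b : 0 < @weight n p b.
Proof. by rewrite exprn_gt0// invr_gt0 sqrtr_gt0 ltr_pwDl// sqnorm_ge0. Qed.

Lemma weight_ge0 n p b : 0 <= @weight n p b.
Proof. exact/ltW/weight_gt0. Qed.

Lemma measurable_weight n p : measurable_fun setT (@weight n p : borel_rV R n -> measurableTypeR R).
Proof.
apply: measurable_funX; apply: measurable_invsqrt => [|x].
  by apply: measurable_funD => //; exact: measurable_sqnorm.
by rewrite addr_ge0// sqnorm_ge0.
Qed.

Definition weight_integral n p : \bar R := (\int[@lebesgue_rV R n]_b (weight p b)%:E)%E.

Let measurable_weightE n p : measurable_fun setT (fun b : borel_rV R n => (weight p b)%:E).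
Proof. by apply/measurable_EFinP; exact: measurable_weight. Qed.

(** With [h^2 = 1 + s^2], substituting [h b] for [b] factors [h] out of
    [1 + s^2 + |b|^2 = h^2 + |b|^2]. *)
Lemma weight_integral_slice n p (s : R) : (n <= p)%N ->
  (\int[@lebesgue_rV R n]_b (weight p (cons_rV (s, b) : 'rV_n.+1))%:E =
   ((Num.sqrt (1 + s ^+ 2))^-1 ^+ (p - n))%:E * weight_integral n p)%E.
Proof.
move=> np; set h := Num.sqrt (1 + s ^+ 2).
have h0 : 0 < h by rewrite sqrtr_gt0 ltr_pwDl// sqr_ge0.
have h2 : h ^+ 2 = 1 + s ^+ 2 by rewrite sqr_sqrtr// addr_ge0// sqr_ge0.
have uM : h%:M \in @unitmx R n by rewrite unitmxE det_scalar unitrX// unitfE gt_eqF.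
pose f (b : borel_rV R n) := (weight p (cons_rV (s, b) : 'rV_n.+1))%:E.
have mf : measurable_fun setT f.
  apply/measurable_EFinP.
  exact: (measurableT_comp (@measurable_weight n.+1 p) (@measurable_cons_rVr R n s)).
have f0 b : (0 <= f b)%E by rewrite lee_fin weight_ge0.
have := scales_integral_unitmx uM mf f0.
have fh b : f (b *m h%:M) = ((h^-1 ^+ p)%:E * (weight p b)%:E)%E.
  rewrite /f /weight -EFinM -exprMn mul_mx_scalar sqnorm_cons sqnormZ; congr (_ ^+ _)%:E.
  rewrite addrA -h2 -[X in X + _]mulr1 -mulrDr sqrtrM ?sqr_ge0// sqrtr_sqr gtr0_norm//.
  by rewrite invfM.
under eq_integral do rewrite fh.
rewrite (ge0_integralZl_EFin _ measurableT) => [|x _||]; last 3 first.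
- by rewrite lee_fin weight_ge0.
- exact: measurable_weightE.
- by rewrite exprn_ge0// invr_ge0 ltW.
rewrite det_scalar normrX gtr0_norm// => E.
have -> : (\int[@lebesgue_rV R n]_b f b =
    (h ^+ n)%:E * ((h ^+ n)^-1%:E * \int[@lebesgue_rV R n]_b f b))%E.
  by rewrite muleA -EFinM mulfV ?mul1e// expf_neq0// gt_eqF.
rewrite -E muleA -EFinM; congr (_%:E * _)%E.
rewrite -{1}(subnK np) exprD mulrCA -exprMn mulfV ?gt_eqF// expr1n mulr1//.
Qed.

(** On the cube of side 2 the weight is at least [(1 + n)^(-p/2)]. *)
Lemma weight_integral_gt0 n p : (0 < weight_integral n p)%E.
Proof.
pose c : R := (Num.sqrt (1 + n%:R))^-1 ^+ p.
have c0 : 0 < c by rewrite exprn_gt0// invr_gt0 sqrtr_gt0 ltr_pwDl.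
apply: (@lt_le_trans _ _ (c%:E * lebesgue_rV (cube n (1:R)))%E).
  by rewrite lebesgue_cube// mule_gt0// lte_fin// exprn_gt0.
rewrite -(integral_cst _ (@measurable_cube R n 1)).
apply: (@le_trans _ _ (\int[@lebesgue_rV R n]_(b in cube n 1) (weight p b)%:E)%E); last first.
  apply: ge0_subset_integral => //; first exact: measurable_cube.
  by move=> x _; rewrite lee_fin weight_ge0.
apply: ge0_le_integral => //.
- exact: measurable_cube.
- by move=> x _; rewrite lee_fin ltW.
- exact: measurable_funTS.
- move=> x x1; rewrite lee_fin lerXn2r ?nnegrE ?invr_ge0 ?sqrtr_ge0//.
  rewrite lef_pV2 ?posrE ?sqrtr_gt0 ?ltr_pwDl ?sqnorm_ge0//.
  rewrite ler_wsqrtr// lerD2l.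
  apply: (@le_trans _ _ (\sum_(i < n) 1)); last by rewrite sumr_const card_ord.
  apply: ler_sum => i _; rewrite -[leLHS]real_normK ?num_real//.
  by rewrite expr_le1// (x1 i).
Qed.

Lemma integral_oneDsqrV_lty :
  (\int[lebesgue_measure]_s (oneDsqr s)^-1%:E < +oo :> \bar R)%E.
Proof.
pose f (s : measurableTypeR R) := ((oneDsqr (s : R))^-1%:E : \bar R).
have mf : measurable_fun setT f.
  apply/measurable_EFinP; apply: continuous_measurable_fun; exact: continuous_oneDsqrV.
have f0 s : (0 <= f s)%E by rewrite lee_fin invr_ge0// (le_trans _ (oneDsqr_ge1 _)).
have Ey : (\int[lebesgue_measure]_(s in `[0%R, +oo[) f s = (pi / 2)%:E)%E.
  exact: integral0y_oneDsqr.
have ENy : (\int[lebesgue_measure]_(s in `]-oo, 0%R]) f s = (pi / 2)%:E)%E.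
  rewrite -Ey (ge0_integration_by_substitution0 mf f0); apply: eq_integral => s _.
  by rewrite /f /oneDsqr sqrrN.
change (\int[lebesgue_measure]_s f s < +oo)%E.
have -> : [set: measurableTypeR R] = `]-oo, 0%R[ `|` `[0%R, +oo[.
  apply/esym; rewrite -subTset => s _ /=; rewrite !in_itv/= andbT.
  by case: (ltP s 0) => _; [left|right].
rewrite ge0_integral_setU//=; last first.
  apply/disj_setPS => s [] /=; rewrite !in_itv/= andbT => s0.
  by rewrite leNgt s0.
  exact: measurable_funTS.
rewrite Ey; apply: lte_add_pinfty; rewrite ?ltry//.
apply: le_lt_trans (ltry (pi / 2)); rewrite -ENy.
apply: ge0_subset_integral => //; first exact: measurable_funTS.
by move=> s /=; rewrite !in_itv/=; exact: ltW.
Qed.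

(** Slicing off one coordinate leaves the integral of [1 / (1 + s^2)] times an
    integral in one dimension less with a smaller integrand. *)
Lemma weight_integral_lty n : (weight_integral n n.+1 < +oo)%E.
Proof.
have weight_le1 p d (b : 'rV[R]_d) : weight p b <= 1.
  rewrite exprn_ile1// ?invr_ge0// invf_le1 ?sqrtr_gt0 ?ltr_pwDl ?sqnorm_ge0//.
  by rewrite -[leLHS]sqrtr1 ler_wsqrtr// lerDl sqnorm_ge0.
elim: n => [|n IH].
  apply: (@le_lt_trans _ _ (\int[@lebesgue_rV R 0]_b cst 1 b)%E).
    apply: ge0_le_integral => // b _; first by rewrite lee_fin weight_ge0.
    by rewrite lee_fin.
  rewrite integral_cst// mul1e (_ : setT = eball 0 1); first exact: lebesgue_eball_lty.
  by apply/seteqP; split => x _//; rewrite /eball/= /sqnorm big_ord0 expr1n.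
rewrite /weight_integral (integral_rVS_head (@measurable_weightE _ _)) => [|x]; last first.
  by rewrite lee_fin weight_ge0.
have E (s : R) : (\int[@lebesgue_rV R n]_b (weight n.+2 (cons_rV (s, b) : 'rV_n.+1))%:E =
    (oneDsqr s)^-1%:E * weight_integral n n.+2)%E.
  rewrite weight_integral_slice; last by rewrite ltnW.
  rewrite (_ : n.+2 - n = 2)%N; last by rewrite -addn2 addKn.
  by rewrite exprVn sqr_sqrtr// addr_ge0// sqr_ge0.
under eq_integral do rewrite E.
have w0 p d : (0 <= weight_integral d p)%E.
  by apply: integral_ge0 => x _; rewrite lee_fin weight_ge0.
rewrite ge0_integralZr//=.
- apply: lte_mul_pinfty; first by apply: integral_ge0 => s _; rewrite lee_fin invr_ge0.
    rewrite ge0_fin_numE ?integral_oneDsqrV_lty//.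
    by apply: integral_ge0 => s _; rewrite lee_fin invr_ge0.
  apply: le_lt_trans IH; apply: ge0_le_integral => //.
  + by move=> x _; rewrite lee_fin weight_ge0.
  + by move=> x _; rewrite lee_fin /weight exprS ler_piMl ?weight_ge0// (weight_le1 1).
- by apply/measurable_EFinP; apply: continuous_measurable_fun; exact: continuous_oneDsqrV.
Qed.

End inverse_power_weight.

(** * Hyperplanes as graphs *)

(** The Householder reflection along [x - y]. *)
Lemma orthogonal_mx_mapping (R : realType) n (x y : 'rV[R]_n) : sqnorm x = sqnorm y ->
  exists Q : 'M[R]_n, Q *m Q^T = 1%:M /\ x *m Q^T = y.
Proof.
move=> xy; pose u := x - y; pose s := sqnorm u.
have [s0|s0] := eqVneq s 0.
  exists 1%:M; rewrite trmx1 !mulmx1; split => //.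
  by apply/eqP; rewrite -subr_eq0 -sqnorm_eq0; apply/eqP.
have uu : u *m u^T = s%:M by rewrite [LHS]mx11_scalar -sqnormE.
pose Q := 1%:M - (2 / s) *: (u^T *m u).
have QT : Q^T = Q by rewrite /Q linearB linearZ/= trmx1 trmx_mul trmxK.
have xu : (x *m u^T) ord0 ord0 = s / 2.
  have yx : (y *m x^T) ord0 ord0 = (x *m y^T) ord0 ord0.
    by rewrite -[y *m x^T]trmxK trmx_mul trmxK mxE.
  have -> : s = (x *m x^T) ord0 ord0 - (y *m x^T) ord0 ord0
      - ((x *m y^T) ord0 ord0 - (y *m y^T) ord0 ord0).
    rewrite /s sqnormE /u linearB/= mulmxBr !mulmxBl !mxE; ring.
  rewrite -!sqnormE -xy yx /u linearB/= mulmxBr [LHS]mxE -sqnormE [X in _ + X]mxE.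
  by field.
exists Q; rewrite QT; split.
  have PP : u^T *m u *m (u^T *m u) = s *: (u^T *m u).
    by rewrite mulmxA -(mulmxA u^T) uu mul_mx_scalar -scalemxAl.
  rewrite {1}/Q mulmxBl mul1mx -scalemxAl {2}/Q mulmxBr mulmx1 -scalemxAr PP.
  rewrite scalerA scalerBr scalerA (_ : 2 / s * (2 / s * s) = 2 / s + 2 / s); last by field.
  by rewrite scalerDl opprB addrK /Q subrK.
rewrite /Q mulmxBr mulmx1 -scalemxAr mulmxA [x *m u^T]mx11_scalar xu mul_scalar_mx scalerA.
rewrite (_ : 2 / s * (s / 2) = 1); last by field.
by rewrite scale1r /u opprB addrC subrK.
Qed.

Section graph_hyperplane.
Variables (R : realType) (m : nat).

Definition graph_mx (a : 'rV[R]_m) : 'M[R]_(m, m.+1) :=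
  (row_mx a^T 1%:M : 'M[R]_(m, 1 + m)).

Lemma mulmx_graph_mx a (y : 'rV[R]_m) :
  y *m graph_mx a = cons_rV ((y *m a^T) ord0 ord0, y).
Proof. by rewrite /graph_mx [LHS](@mul_mx_row _ 1 m 1 m) mulmx1 [y *m a^T in LHS]mx11_scalar. Qed.

Lemma graph_mx_row_free a : row_free (graph_mx a).
Proof.
apply/row_freeP; exists (col_mx 0 1%:M : 'M[R]_(1 + m, m)).
by rewrite [LHS](@mul_row_col _ m 1 m m) mulmx0 mulmx1 add0r.
Qed.

(** Factor [[1, -a; a^T, 1]] in the two orders of elimination: one exhibits the
    Gram matrix [1 + a^T a], the other the scalar [1 + a a^T]. *)
Lemma det_graph_mx_gram a : \det (graph_mx a *m (graph_mx a)^T) = 1 + sqnorm a.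
Proof.
have -> : graph_mx a *m (graph_mx a)^T = a^T *m a + 1%:M.
  rewrite [X in _ *m X](@tr_row_mx _ m 1 m) [LHS](@mul_row_col _ m 1 m m).
  by rewrite trmxK trmx1 mulmx1.
pose N : 'M[R]_(1 + m) := block_mx 1%:M (- a) a^T 1%:M.
have E1 : N = block_mx 1%:M 0 a^T 1%:M *m block_mx 1%:M (- a) 0 (a^T *m a + 1%:M).
  by rewrite mulmx_block !mul1mx !mulmx1 !mul0mx !addr0 mulmxN addKr.
have E2 : N = block_mx (1 + sqnorm a)%:M (- a) 0 1%:M *m block_mx 1%:M 0 a^T 1%:M.
  rewrite mulmx_block !mul1mx !mulmx1 ?mul0mx ?mulmx0 ?addr0 ?add0r mulNmx.
  by rewrite [a *m a^T]mx11_scalar -sqnormE raddfD/= addrK.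
transitivity (\det N); first by rewrite E1 det_mulmx det_lblock det_ublock !det1 !mul1r.
by rewrite E2 det_mulmx det_lblock det_ublock !det1 det_scalar1 !mulr1.
Qed.

Lemma lebesgue_graph_section a : exists B : 'M[R]_(m, m.+1), B *m B^T = 1%:M /\
  forall A : set (borel_rV R m.+1), measurable A ->
  lebesgue_rV ((mulmxr (graph_mx a) : _ -> 'rV[R]_m.+1) @^-1` A) =
  ((Num.sqrt (1 + sqnorm a))^-1%:E * lebesgue_rV ((mulmxr B : _ -> 'rV[R]_m.+1) @^-1` A))%E.
Proof.
have [B [BB BT]] := gram_schmidt (graph_mx_row_free a).
exists B; split => // A mA.
rewrite (lebesgue_rV_row_basis (graph_mx_row_free a) BB _ mA) ?det_graph_mx_gram//.
by rewrite BT.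
Qed.

End graph_hyperplane.

(** * The bathtub principle *)

(** After cancelling the finite integral over [B `&` D], the hypothesis compares
    [B `\` D], where [f] is large, with [D `\` B], where [f] is small. *)
Lemma bathtub d (T : measurableType d) (R : realType) (mu : {measure set T -> \bar R})
    (f : T -> \bar R) (k : R) (B D : set T) :
  measurable B -> measurable D -> measurable_fun setT f -> (forall x, (0 <= f x)%E) ->
  0 < k ->
  (forall x, (D `\` B) x -> (f x <= k%:E)%E) -> (forall x, (B `\` D) x -> (k%:E <= f x)%E) ->
  (\int[mu]_(x in B) f x < +oo)%E ->
  (\int[mu]_(x in B) f x <= \int[mu]_(x in D) f x)%E ->
  (mu B <= mu D)%E.
Proof.
move=> mB mD mf f0 k0 fk kf Boo BD.
have mI : measurable (B `&` D) by exact: measurableI.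
have mBD : measurable (B `\` D) by exact: measurableD.
have mDB : measurable (D `\` B) by exact: measurableD.
have split E F : measurable E -> measurable F ->
    (\int[mu]_(x in E) f x = \int[mu]_(x in E `&` F) f x + \int[mu]_(x in E `\` F) f x)%E.
  move=> mE mF; rewrite -ge0_integral_setU ?setUIDK//.
  - exact: measurableI.
  - exact: measurableD.
  - exact: measurable_funTS.
  - by apply/disj_setPS => x [[_ Fx] [_]].
have fI : (\int[mu]_(x in B `&` D) f x)%E \is a fin_num.
  rewrite ge0_fin_numE; last by apply: integral_ge0.
  apply: le_lt_trans Boo; apply: ge0_subset_integral => //; exact: measurable_funTS.
move: BD; rewrite (split B D)// (split D B)// [D `&` B]setIC leeD2lE// => BD.
have : (k%:E * mu (B `\` D) <= k%:E * mu (D `\` B))%E.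
  rewrite -!integral_cst//; apply: le_trans (le_trans BD _).
    apply: ge0_le_integral => //=; first by move=> x _; rewrite lee_fin ltW.
    exact: measurable_funTS.
  apply: ge0_le_integral => //=; exact: measurable_funTS.
rewrite lee_pmul2l// => le_mu.
rewrite (measureDI mu mB mD) (measureDI mu mD mB) [D `&` B]setIC.
exact: leeD2r.
Qed.

(** * Integrating the sections over all hyperplanes *)
Section section_average.
Variables (R : realType) (m' : nat).
Let m := m'.+1.
Local Notation C := (@weight_integral R m' m).

Lemma weight_mulmx n p (Q : 'M[R]_n) (a : 'rV[R]_n) : Q *m Q^T = 1%:M ->
  weight p (a *m Q) = weight p a.
Proof. by move=> QQ; rewrite /weight sqnorm_mulmx. Qed.

Lemma scales_integral_orthogonal n (Q : 'M[R]_n) (f : borel_rV R n -> \bar R) :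
  Q *m Q^T = 1%:M -> measurable_fun setT f -> (forall x, (0 <= f x)%E) ->
  (\int[@lebesgue_rV R n]_x f ((x : 'rV_n) *m Q)%R = \int[@lebesgue_rV R n]_x f x)%E.
Proof.
move=> QQ mf f0; have [uQ _] := mulmx1_unit QQ.
rewrite (scales_integral_unitmx uQ mf f0).
have : \det Q ^+ 2 = 1 by rewrite expr2 -{2}det_tr -det_mulmx QQ det1.
rewrite -real_normK ?num_real// => /eqP; rewrite sqrp_eq1// => /eqP ->.
by rewrite invr1 mul1e.
Qed.

(** The weight is rotation invariant, so [y] may be replaced by [(|y|, 0)]; the
    inner product is then [|y|] times the first coordinate of [a], and the
    remaining coordinates integrate to [C] by [weight_integral_slice]. *)
Lemma weighted_integral_inner (y : 'rV[R]_m) (phi : measurableTypeR R -> \bar R) :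
  y != 0 -> measurable_fun setT phi -> (forall t, (0 <= phi t)%E) ->
  (\int[@lebesgue_rV R m]_a ((weight m a)%:E * phi ((y *m (a : 'rV_m)^T) ord0 ord0)) =
   \int[lebesgue_measure]_t (C * (Num.sqrt (t ^+ 2 + sqnorm y))^-1%:E * phi t))%E.
Proof.
move=> y0 mphi phi0; pose r := Num.sqrt (sqnorm y).
have r0 : 0 < r by rewrite sqrtr_gt0 lt_neqAle eq_sym sqnorm_eq0 y0 sqnorm_ge0.
have r2 : r ^+ 2 = sqnorm y by rewrite sqr_sqrtr// sqnorm_ge0.
pose e : 'rV[R]_m := cons_rV (r, 0 : 'rV[R]_m').
have [Q [QQ yQ]] : exists Q : 'M[R]_m, Q *m Q^T = 1%:M /\ y *m Q^T = e.
  apply: orthogonal_mx_mapping; rewrite sqnorm_cons r2.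
  by rewrite (_ : sqnorm 0 = 0) ?addr0//; apply/eqP; rewrite sqnorm_eq0.
have mw n : measurable_fun setT (fun a : borel_rV R n => (weight m a)%:E : \bar R).
  by apply/measurable_EFinP; exact: measurable_weight.
have minner : measurable_fun setT (fun a : borel_rV R m =>
    (y *m (a : 'rV[R]_m)^T) ord0 ord0 : measurableTypeR R).
  under eq_fun do rewrite mxE.
  apply: measurable_sum => j; apply: measurable_funM => //.
  under eq_fun do rewrite mxE; exact: measurable_coord.
pose f (a : borel_rV R m) := ((weight m a)%:E * phi ((y *m (a : 'rV_m)^T) ord0 ord0))%E.
have mf : measurable_fun setT f.
  by apply: emeasurable_funM; [exact: mw|exact: (measurableT_comp mphi minner)].
have f0 a : (0 <= f a)%E by rewrite mule_ge0// lee_fin weight_ge0.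
rewrite -[LHS]/(\int[_]_a f a)%E -(scales_integral_orthogonal QQ mf f0).
have fQ s b : f (cons_rV (s, b) *m Q) = ((weight m (cons_rV (s, b) : 'rV_m))%:E * phi (s * r)%R)%E.
  rewrite /f weight_mulmx//; congr (_ * phi _)%E.
  rewrite trmx_mul mulmxA yQ mxE big_ord_recl big1 => [|i _].
    by rewrite addr0 [_^T _ _]mxE /e !cons_rV0/= mulrC.
  by rewrite /e cons_rVS /= mxE mul0r.
pose g (a : borel_rV R m) := f ((a : 'rV_m) *m Q).
have mg : measurable_fun setT g := measurableT_comp mf (@measurable_mulmx R m m Q).
rewrite -[LHS]/(\int[_]_a g a)%E (integral_rVS_head mg) => [|a]; last exact: f0.
(* The integrand left after integrating out all coordinates but the first,
   as a function of t = s * r. *)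
pose G (t : measurableTypeR R) := (((Num.sqrt (1 + (t * r^-1) ^+ 2))^-1)%:E * C * phi t)%E.
have C0 : (0 <= C)%E by rewrite ltW// weight_integral_gt0.
have mG : measurable_fun setT G.
  apply: emeasurable_funM => //; apply: emeasurable_funM => //.
  apply/measurable_EFinP; apply: measurable_invsqrt => [|t]; last by rewrite addr_ge0// sqr_ge0.
  by apply: measurable_funD => //; apply: measurable_funX; exact: measurable_funM.
have G0 t : (0 <= G t)%E by rewrite !mule_ge0// lee_fin invr_ge0 sqrtr_ge0.
transitivity (\int[lebesgue_measure]_s G (s * r)%R)%E.
  apply: eq_integral => s _.
  under eq_integral do rewrite /g fQ.
  rewrite ge0_integralZr//.
  - rewrite weight_integral_slice// subSnn expr1.
    by rewrite /G mulfK// gt_eqF.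
  - apply/measurable_EFinP.
    exact: (measurableT_comp (@measurable_weight R m m) (@measurable_cons_rVr R m' s)).
  - by move=> b _; rewrite lee_fin weight_ge0.
rewrite (integral_scale1 _ mG G0) ?gt_eqF//.
have ir0 : 0 <= `|r|^-1 by rewrite invr_ge0.
rewrite -(ge0_integralZl_EFin lebesgue_measure measurableT (fun t _ => G0 t) mG ir0).
apply: eq_integral => t _; rewrite /G gtr0_norm// !muleA; congr (_ * _)%E.
rewrite -EFinM muleC; congr (_ * _%:E)%E.
rewrite -invfM; congr (_^-1).
rewrite -{1}(gtr0_norm r0) -sqrtr_sqr -sqrtrM ?sqr_ge0//; congr (Num.sqrt _).
by rewrite mulrDr mulr1 -exprMn mulrCA mulfV ?gt_eqF// mulr1 r2 addrC.
Qed.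


Lemma measurable_mulmx_graph_mx :
  measurable_fun setT (fun p : borel_rV R m * borel_rV R m =>
    (p.2 : 'rV[R]_m) *m graph_mx (p.1 : 'rV[R]_m) : borel_rV R m.+1).
Proof.
under eq_fun do rewrite mulmx_graph_mx.
apply: (measurableT_comp (@measurable_cons_rV R m)); apply: measurable_fun_pair => //=.
under eq_fun do rewrite mxE.
apply: measurable_sum => j; apply: measurable_funM.
  exact: (measurableT_comp (@measurable_coord R m j) measurable_snd).
under eq_fun do rewrite mxE.
exact: (measurableT_comp (@measurable_coord R m j) measurable_fst).
Qed.

Lemma measurable_graph_section (E : set (borel_rV R m.+1)) : measurable E ->
  measurable_fun setT (fun a : borel_rV R m =>
    lebesgue_rV ((mulmxr (graph_mx (a : 'rV[R]_m)) : _ -> 'rV[R]_m.+1) @^-1` E)).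
Proof.
move=> mE.
have mS := measurable_mulmx_graph_mx measurableT mE; rewrite setTI in mS.
have := measurable_fun_xsection (@lebesgue_rV R m) mS.
by congr measurable_fun; apply/funext => a; congr lebesgue_rV;
  apply/seteqP; split => y; rewrite /xsection/= inE.
Qed.

(** Tonelli's theorem reduces the left-hand side to the inner integrals of
    [weighted_integral_inner], which cover all [y] but the null set [y = 0]. *)
Lemma weighted_section_integral (E : set (borel_rV R m.+1)) : measurable E ->
  (\int[@lebesgue_rV R m]_a ((weight m a)%:E *
     lebesgue_rV ((mulmxr (graph_mx (a : 'rV[R]_m)) : _ -> 'rV[R]_m.+1) @^-1` E)) =
   \int[@lebesgue_rV R m.+1]_(x in E) (C * (Num.sqrt (sqnorm (x : 'rV_m.+1)))^-1%:E))%E.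
Proof.
move=> mE.
have C0 : (0 <= C)%E by rewrite ltW// weight_integral_gt0.
pose I (x : borel_rV R m.+1) := ((\1_E x)%:E : \bar R).
have mI : measurable_fun setT I by apply/measurable_EFinP; exact: measurable_indic.
have I0 x : (0 <= I x)%E by rewrite lee_fin.
pose q (x : borel_rV R m.+1) := (C * (Num.sqrt (sqnorm (x : 'rV_m.+1)))^-1%:E)%E.
have mq : measurable_fun setT q.
  apply: emeasurable_funM => //; apply/measurable_EFinP.
  by apply: measurable_invsqrt => [|x]; [exact: measurable_sqnorm|exact: sqnorm_ge0].
have q0 x : (0 <= q x)%E by rewrite mule_ge0// lee_fin invr_ge0 sqrtr_ge0.
have mqI : measurable_fun setT (fun x => q x * I x)%E by exact: emeasurable_funM.
have qI0 x : (0 <= q x * I x)%E by exact: mule_ge0.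
have mw : measurable_fun setT (fun a : borel_rV R m => (weight m a)%:E : \bar R).
  by apply/measurable_EFinP; exact: measurable_weight.
pose k (p : borel_rV R m * borel_rV R m) : borel_rV R m.+1 :=
  (p.2 : 'rV_m) *m graph_mx (p.1 : 'rV_m).
have mk : measurable_fun setT k := measurable_mulmx_graph_mx.
pose f (p : borel_rV R m * borel_rV R m) := ((weight m (p.1 : 'rV_m))%:E * I (k p))%E.
have mf : measurable_fun setT f.
  apply: emeasurable_funM; last exact: (measurableT_comp mI mk).
  exact: (measurableT_comp mw measurable_fst).
have f0 p : (0 <= f p)%E by rewrite mule_ge0// lee_fin weight_ge0.
transitivity (\int[@lebesgue_rV R m]_a \int[@lebesgue_rV R m]_y f (a, y))%E.
  apply: eq_integral => a _.
  have mIk : measurable_fun setT (fun y => I (k (a, y))).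
    exact: (measurableT_comp mI (measurableT_comp mk (measurable_pair1 a))).
  transitivity ((weight m a)%:E * \int[@lebesgue_rV R m]_y I (k (a, y)))%E; last first.
    exact/esym/(ge0_integralZl_EFin _ measurableT (fun y _ => I0 _) mIk (weight_ge0 m a)).
  congr (_ * _)%E.
  have mT : measurable
      ((mulmxr (graph_mx (a : 'rV[R]_m)) : borel_rV R m -> borel_rV R m.+1) @^-1` E).
    exact: measurable_preimage_mulmx.
  rewrite -[in LHS](setIT (_ @^-1` _)) -(integral_indic _ measurableT mT).
  by [].
rewrite (fubini_tonelli f)//.
have mN := @measurable_rV_set0 R m.
have N0 := @lebesgue_rV_set0 R m (ltn0Sn _).
rewrite [RHS]integral_mkcond.
have -> : (\int[@lebesgue_rV R m.+1]_x (q \_ E) x = \int[@lebesgue_rV R m.+1]_x (q x * I x))%E.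
  by apply: eq_integral => x _; rewrite epatch_indic.
rewrite (integral_rVS_tail mqI)//.
have mL : measurable_fun setT (fun y => \int[@lebesgue_rV R m]_a f (a, y))%E.
  exact: (measurable_fun_fubini_tonelli_G f).
have mG : measurable_fun setT
    (fun y : borel_rV R m => \int[lebesgue_measure]_t (q (cons_rV (t, y)) * I (cons_rV (t, y))))%E.
  exact: (measurable_fun_fubini_tonelli_G ((fun x => q x * I x)%E \o @cons_rV R m)
    (measurableT_comp mqI (@measurable_cons_rV R m)) (fun x => qI0 _)).
rewrite (ge0_negligible_integral mN measurableT mL _ N0) => [|y _]; last exact: integral_ge0.
rewrite (ge0_negligible_integral mN measurableT mG _ N0) => [|y _]; last exact: integral_ge0.
apply: eq_integral => y; rewrite inE => -[_ /eqP y0].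
have mphi := measurableT_comp mI (@measurable_cons_rVl R m y).
under eq_integral do rewrite /f /k/= mulmx_graph_mx.
rewrite [LHS](weighted_integral_inner y0 mphi (fun t => I0 _)).
by apply: eq_integral => t _; rewrite /q sqnorm_cons.
Qed.

End section_average.

(** * Comparison with balls *)

(** The origin is removed from the ball, because the density [C / |x|] takes the
    value 0 there: [0^-1 = 0]. *)
Lemma ball_comparison_hyperplane (R : realType) m' (r : R) (D : set (borel_rV R m'.+2)) :
  0 < r -> measurable D ->
  (forall B : 'M[R]_(m'.+1, m'.+2), B *m B^T = 1%:M ->
    (lebesgue_rV (eball m'.+1 r) <= lebesgue_rV ((mulmxr B : _ -> 'rV[R]_m'.+2) @^-1` D))%E) ->
  (lebesgue_rV (eball m'.+2 r) <= lebesgue_rV D)%E.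
Proof.
set m := m'.+1 => r0 mD BD.
have C0 := weight_integral_gt0 R m' m.
have Coo := weight_integral_lty R m'.
have CE : weight_integral R m' m = (fine (weight_integral R m' m))%:E.
  by rewrite fineK// ge0_fin_numE// ltW.
set c := fine _ in CE.
have c0 : 0 < c by rewrite -lte_fin -CE.
have mB := @measurable_eball R m.+1 r.
have mB0 : measurable (eball m.+1 r `\ 0 : set (borel_rV R m.+1)).
  by apply: measurableD => //; exact: measurable_rV_set0.
have -> : lebesgue_rV (eball m.+1 r) = lebesgue_rV (eball m.+1 r `\ 0 : set 'rV[R]_m.+1).
  rewrite (measureDI (@lebesgue_rV R m.+1) mB (@measurable_rV_set0 R m.+1)).
  rewrite [X in (_ + X)%E](_ : _ = 0%E) ?adde0//.
  apply: (subset_measure0 _ _ _ (@lebesgue_rV_set0 R m.+1 _)) => //.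
  - by apply: measurableI => //; exact: measurable_rV_set0.
  - exact: measurable_rV_set0.
pose q (x : borel_rV R m.+1) :=
  (weight_integral R m' m * (Num.sqrt (sqnorm (x : 'rV[R]_m.+1)))^-1%:E)%E.
have mq : measurable_fun setT q.
  apply: emeasurable_funM => //; apply/measurable_EFinP.
  by apply: measurable_invsqrt => [|x]; [exact: measurable_sqnorm|exact: sqnorm_ge0].
have q0 x : (0 <= q x)%E by rewrite mule_ge0 ?(ltW C0)// lee_fin invr_ge0 sqrtr_ge0.
have qB0 : (\int[@lebesgue_rV R m.+1]_(x in eball m.+1 r `\ 0%R) q x <=
    \int[@lebesgue_rV R m.+1]_(x in eball m.+1 r) q x)%E.
  by apply: ge0_subset_integral => //; exact: measurable_funTS.
have sectionE E (a : 'rV[R]_m) : measurable (E : set (borel_rV R m.+1)) ->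
    exists B : 'M[R]_(m, m.+1), B *m B^T = 1%:M /\
    ((weight m a)%:E * lebesgue_rV ((mulmxr (graph_mx a) : _ -> 'rV[R]_m.+1) @^-1` E) =
    (weight m.+1 a)%:E * lebesgue_rV ((mulmxr B : _ -> 'rV[R]_m.+1) @^-1` E))%E.
  move=> mE; have [B [BB BE]] := lebesgue_graph_section a.
  by exists B; split => //; rewrite BE// muleA -EFinM -exprSr.
(* The sections of a ball are balls of the same radius, whatever the plane. *)
have BE (a : 'rV[R]_m) :
   ((weight m a)%:E * lebesgue_rV ((mulmxr (graph_mx a) : _ -> 'rV[R]_m.+1) @^-1` eball m.+1 r) =
    (weight m.+1 a)%:E * lebesgue_rV (eball m r))%E.
  by have [B [BB ->]] := sectionE _ a mB; rewrite eball_preimage.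
have qB : (\int[@lebesgue_rV R m.+1]_(x in eball m.+1 r) q x =
    weight_integral R m m.+1 * lebesgue_rV (eball m r))%E.
  rewrite -weighted_section_integral//; under eq_integral do rewrite BE.
  rewrite ge0_integralZr//.
  - by apply/measurable_EFinP; exact: measurable_weight.
  - by move=> a _; rewrite lee_fin weight_ge0.
have qBD : (\int[@lebesgue_rV R m.+1]_(x in eball m.+1 r) q x <=
    \int[@lebesgue_rV R m.+1]_(x in D) q x)%E.
  rewrite -(weighted_section_integral mB) -(weighted_section_integral mD).
  have mw : measurable_fun setT (fun a : borel_rV R m => (weight m a)%:E : \bar R).
    by apply/measurable_EFinP; exact: measurable_weight.
  apply: ge0_le_integral => //.
  - by move=> a _; rewrite mule_ge0// lee_fin weight_ge0.
  - by apply: emeasurable_funM => //; exact: measurable_graph_section.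
  - by apply: emeasurable_funM => //; exact: measurable_graph_section.
  - move=> a _; rewrite BE; have [B [BB ->]] := sectionE _ a mD.
    by rewrite lee_wpmul2l ?lee_fin ?weight_ge0// BD.
apply: (@bathtub _ _ _ _ q (c / r)) => //.
- by rewrite divr_gt0.
- move=> x [_ xB]; rewrite /q CE -EFinM lee_fin ler_pM2l//.
  have [->|x0] := eqVneq (x : 'rV[R]_m.+1) 0.
    by rewrite (_ : sqnorm 0 = 0) ?sqrtr0 ?invr0 ?invr_ge0 ?ltW//; apply/eqP; rewrite sqnorm_eq0.
  have sx0 : 0 < sqnorm (x : 'rV[R]_m.+1) by rewrite lt_neqAle eq_sym sqnorm_eq0 x0 sqnorm_ge0.
  rewrite lef_pV2 ?posrE ?sqrtr_gt0//.
  rewrite -(gtr0_norm r0) -sqrtr_sqr ler_wsqrtr// leNgt; apply/negP => /ltW xr.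
  by apply: xB; split => //; exact/eqP.
- move=> x [[xr /eqP x0] _]; rewrite /q CE -EFinM lee_fin ler_pM2l//.
  have sx0 : 0 < sqnorm (x : 'rV[R]_m.+1) by rewrite lt_neqAle eq_sym sqnorm_eq0 x0 sqnorm_ge0.
  rewrite lef_pV2 ?posrE ?sqrtr_gt0//.
  by rewrite -[leRHS](gtr0_norm r0) -sqrtr_sqr ler_wsqrtr.
- apply: le_lt_trans qB0 _; rewrite qB.
  apply: lte_mul_pinfty; last exact: lebesgue_eball_lty.
    by rewrite ltW// weight_integral_gt0.
  by rewrite ge0_fin_numE ?weight_integral_lty// ltW// weight_integral_gt0.
- exact: le_trans qB0 qBD.
Qed.

(** A section of a hyperplane section of [D] is a section of [D], so the
    induction hypothesis bounds all hyperplane sections of [D] from below. *)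
Lemma ball_comparison (R : realType) m n (r : R) (D : set (borel_rV R n)) :
  (0 < m <= n)%N -> 0 < r -> measurable D ->
  (forall B : 'M[R]_(m, n), B *m B^T = 1%:M ->
    (lebesgue_rV (eball m r) <= lebesgue_rV ((mulmxr B : _ -> 'rV[R]_n) @^-1` D))%E) ->
  (lebesgue_rV (eball n r) <= lebesgue_rV D)%E.
Proof.
move=> + r0; elim: n D => [|n IH] D /andP[m0 mn] mD BD.
  by move: mn; rewrite leqNgt m0.
move: mn; rewrite leq_eqVlt => /predU1P[mn|mn].
  subst m; apply: le_trans (BD 1%:M _) _; first by rewrite trmx1 mulmx1.
  by rewrite (_ : _ @^-1` D = D)//; apply/seteqP; split => x; rewrite /= mulmx1.
case: n => [|n] in IH D mD BD mn *; first by move: mn; rewrite ltnS leqNgt m0.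
apply: ball_comparison_hyperplane => // A AA.
apply: IH; first by rewrite m0.
  exact: measurable_preimage_mulmx.
move=> B BB; have BABA : (B *m A) *m (B *m A)^T = 1%:M.
  by rewrite trmx_mul mulmxA -(mulmxA B) AA mulmx1.
apply: le_trans (BD _ BABA) _; rewrite le_eqVlt; apply/orP; left; apply/eqP.
by congr lebesgue_rV; apply/seteqP; split => x; rewrite /= mulmxA.
Qed.


(** * The volume inequality *)
Lemma vol_eball (R : realType) n (r : R) : 0 < r -> vol (eball n r) = r ^+ n * omega R n.
Proof.
move=> r0; rewrite /vol lebesgue_eball// /omega unit_ballE /vol fineM//.
by rewrite ge0_fin_numE ?lebesgue_eball_lty.
Qed.

Lemma volB (R : realType) n (K L : set 'rV[R]_n) :
  measurable (K : set (borel_rV R n)) -> measurable (L : set (borel_rV R n)) ->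
  (lebesgue_rV K < +oo)%E -> L `<=` K -> vol K - vol L = vol (K `\` L).
Proof.
move=> mK mL Koo LK.
have KE := measureDI (@lebesgue_rV R n) mK mL.
rewrite (setIidr LK) in KE.
have Loo : (lebesgue_rV L < +oo)%E.
  by apply: le_lt_trans Koo; apply: le_measure; rewrite ?inE.
have Doo : (lebesgue_rV (K `\` L) < +oo)%E.
  by apply: le_lt_trans Koo; apply: le_measure; rewrite ?inE//; exact: measurableD.
by rewrite /vol KE fineD ?ge0_fin_numE// addrK.
Qed.

Unset Implicit Arguments.
Set Strict Implicit.
Set Printing Implicit Defensive.

Theorem theorem1p7 (R : realType) (n k : nat) (K L : set 'rV[R]_n)
    (hk : (1 <= k)%N) (hkn : (k < n)%N)
    (bK : bounded_set K) (bL : bounded_set L)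
    (borelK : <<s @open 'rV[R]_n >> K) (borelL : <<s @open 'rV[R]_n >> L)
    (LK : L `<=` K) :
  (vol K - vol L) `^ ((n - k)%N%:R / n%:R) >=
  c_nk R n k ^+ k *
    inf [set vol_in F (K `&` [set` F]) - vol_in F (L `&` [set` F])
        | F in grassmannian R n (n - k)%N].

Proof.
set m := (n - k)%N.
have m0 : (0 < m)%N by rewrite subn_gt0.
have mn : (m <= n)%N by rewrite leq_subr.
have n0 : (0 < n)%N := leq_trans m0 mn.
have mK : measurable (K : set (borel_rV R n)) := borelK.
have mL : measurable (L : set (borel_rV R n)) := borelL.
pose D := K `\` L.
have mD : measurable (D : set (borel_rV R n)) by exact: measurableD.
have [r Kr] := bounded_set_eball bK.
have Koo : (lebesgue_rV K < +oo)%E.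
  apply: le_lt_trans (lebesgue_eball_lty n r).
  by apply: le_measure; rewrite ?inE//; exact: measurable_eball.
have Doo : (lebesgue_rV D < +oo)%E.
  by apply: le_lt_trans Koo; apply: le_measure; rewrite ?inE//; exact: subDsetl.
have sectionE (F : {vspace 'rV[R]_n}) :
    vol_in F (K `&` [set` F]) - vol_in F (L `&` [set` F]) = vol_in F D.
  have [BB BF] : orthonormal_frame F (frame F) by rewrite /frame; case: cid.
  (* The frame already takes its values in F. *)
  have preF A : (mulmxr (frame F) : _ -> 'rV[R]_n) @^-1` (A `&` [set` F]) =
      (mulmxr (frame F) : _ -> 'rV[R]_n) @^-1` A.
    apply/seteqP; split => x /=; first by case.
    move=> Ax; split => //.
    have : x *m frame F \in limg (linfun (mulmxr (frame F))) by rewrite limg_mulmxrE submxMl.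
    by rewrite BF.
  have mpre A : measurable (A : set (borel_rV R n)) ->
      measurable ((mulmxr (frame F) : borel_rV R _ -> borel_rV R n) @^-1` A).
    exact: measurable_preimage_mulmx.
  rewrite /vol_in !preF volB//; [exact: mpre|exact: mpre| |].
    apply: le_lt_trans (lebesgue_eball_lty (\dim F) r).
    apply: le_measure; rewrite ?inE; [exact: mpre|exact: measurable_eball|].
    by rewrite -(eball_preimage r BB); apply: preimage_subset.
  exact: preimage_subset.
rewrite (volB mK mL Koo LK) -/D c_nkE//.
set S := [set _ | _ in _]; set c := inf S.
have S0 : lbound S 0.
  by move=> _ [F _ <-]; rewrite sectionE /vol_in /vol fine_ge0.
have cS (F : {vspace 'rV[R]_n}) : \dim F = m -> c <= vol_in F D.
  by move=> dF; rewrite -sectionE; apply: ge_inf; [exists 0|exists F].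
have omega_ge0 d : 0 <= omega R d by rewrite /omega /vol fine_ge0.
(* A nonpositive infimum makes the lower bound nonpositive. *)
have [c0|c0] := leP c 0.
  apply: le_trans (powR_ge0 _ _).
  by apply: mulr_ge0_le0 => //; rewrite divr_ge0 ?powR_ge0.
have [om0|om0] := eqVneq (omega R m) 0; first by rewrite om0 invr0 mulr0 mul0r powR_ge0.
have omega_gt0 : 0 < omega R m by rewrite lt_neqAle eq_sym om0 omega_ge0.
(* The ball of radius rho in R^m has volume c. *)
pose rho := (c / omega R m) `^ (m%:R^-1).
have rho0 : 0 < rho by rewrite powR_gt0// divr_gt0.
have rhoE : rho ^+ m = c / omega R m.
  rewrite -powR_mulrn ?ltW// -powRrM mulVf ?pnatr_eq0 -?lt0n// powRr1//.
  by rewrite divr_ge0// ltW.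
have : (lebesgue_rV (eball n rho) <= lebesgue_rV D)%E.
  apply: (@ball_comparison _ m) => //; first by rewrite m0.
  move=> B BB; pose F : {vspace 'rV[R]_n} := limg (linfun (mulmxr B)).
  have oB : orthonormal_frame F B by [].
  have := cS F (esym (orthonormal_frame_size oB)).
  rewrite (vol_in_orthonormal_frame oB mD).
  have -> : c = vol (eball m rho) by rewrite vol_eball// rhoE divfK.
  rewrite /vol => le_vol.
  rewrite -(@fineK _ (lebesgue_rV (eball m rho))) ?ge0_fin_numE ?lebesgue_eball_lty//.
  have fine_le_self (e : \bar R) : (0 <= e -> (fine e)%:E <= e)%E.
    by case: e => [x _||] //=; rewrite ?lexx ?leey.
  by apply: le_trans (fine_le_self _ (measure_ge0 _ _)); rewrite lee_fin.
move=> /fine_le; rewrite !ge0_fin_numE ?lebesgue_eball_lty// => /(_ isT Doo).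
rewrite -/(vol _) -/(vol D) vol_eball// => le_vol.
apply: (@le_trans _ _ ((rho ^+ n * omega R n) `^ (m%:R / n%:R))); last first.
  apply: ge0_ler_powR => //; rewrite ?nnegrE ?mulr_ge0 ?exprn_ge0 ?(ltW rho0)//.
  by rewrite /vol fine_ge0.
rewrite powRM ?exprn_ge0 ?(ltW rho0)//.
rewrite -(@powR_mulrn _ rho n) ?(ltW rho0)// -powRrM mulrCA mulfV ?pnatr_eq0 -?lt0n// mulr1.
by rewrite powR_mulrn ?(ltW rho0)// rhoE -[leLHS]mulrA [_^-1 * c]mulrC [leRHS]mulrC.
Qed.
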